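(* Let $H$ be a Hopf algebra with invertible antipode and let $B$ be a braided-commutative algebra in the category of right Drinfeld–Yetter modules over $H$. (i) For any $\varrho\in C^1_{\triangleleft,ver}(H,B)$, we obtain a 2-cocycle $\partial\varrho\in Z^2_\triangleleft(H,B)$ by $$\partial\varrho(h,g)=\varrho^{-1}(h_{(1)})\,(\varrho^{-1}(g_{(1)})\triangleleft h_{(2)})\,\varrho(g_{(2)}h_{(3)})$$ for all $h,g\in H$ (with $\varrho^{-1}$ the convolution inverse). The subset $Z^1_{\triangleleft,ver}(H,B)$ of elements $\varrho\in C^1_{\triangleleft,ver}(H,B)$ for which $\partial\varrho(h,g)=\varepsilon(h)\varepsilon(g)1$ for all $h,g\in H$ is a subgroup isomorphic to $\mathcal B_{ver}(B\#H^{op})^{op}$. (ii) The group $C^1_{\triangleleft,ver}(H,B)$ acts on $Z^2_\triangleleft(H,B)$ by $$\gamma^\varrho(h,g)=\varrho^{-1}(h_{(1)})\,(\varrho^{-1}(g_{(1)})\triangleleft h_{(2)})\,\gamma(h_{(3)},g_{(2)})\,\varrho(g_{(3)}h_{(4)})$$ for $\gamma\in Z^2_\triangleleft(H,B)$ and $\varrho\in C^1_{\triangleleft,ver}(H,B)$. The set $\mathcal H^2_\triangleleft(H,B)$ of orbits under this action can be identified with (is in bijection with) $\mathcal H^2(B\#H^{op},B)$.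
   Context: Everything is over a field $k$; algebras are unital. A right Drinfeld–Yetter module over $H$ is a vector space $B$ with a right $H$-action $\triangleleft$ and a right $H$-coaction $b\mapsto b_{(0)}\otimes b_{(1)}$ such that $(b\triangleleft h_{(2)})_{(0)}\otimes h_{(1)}(b\triangleleft h_{(2)})_{(1)}=b_{(0)}\triangleleft h_{(1)}\otimes b_{(1)}h_{(2)}$. A braided-commutative algebra in this category is such a $B$ that is an algebra which is both a right $H$-module algebra and a right $H$-comodule algebra (with $(ab)_{(0)}\otimes(ab)_{(1)}=a_{(0)}b_{(0)}\otimes a_{(1)}b_{(1)}$), and such that $ab=b_{(0)}(a\triangleleft b_{(1)})$ for all $a,b\in B$. $C^1_{\triangleleft,ver}(H,B)$ is the group under convolution of unital convolution-invertible linear maps $\varrho:H\to B$ with $b_{(0)}\varrho(hb_{(1)})=\varrho(h)b$ and $\varrho(h_{(1)})(b\triangleleft h_{(2)})=(b\triangleleft h_{(1)})\varrho(h_{(2)})$ for all $h\in H$, $b\in B$. $Z^2_\triangleleft(H,B)$ is the set of convolution-invertible linear maps $\gamma:H\otimes H\to B$ such that for all $f,g,h\in H$, $b\in B$: $\gamma(h,1)=\gamma(1,h)=\varepsilon(h)1$; $(\gamma(g_{(1)},f_{(1)})\triangleleft h_{(1)})\gamma(h_{(2)},f_{(2)}g_{(2)})=\gamma(h_{(1)},g_{(1)})\gamma(g_{(2)}h_{(2)},f)$; $\gamma(h_{(1)},g_{(1)})(b\triangleleft(g_{(2)}h_{(2)}))=(b\triangleleft(g_{(1)}h_{(1)}))\gamma(h_{(2)},g_{(2)})$;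 $\gamma(h_{(1)},g)(b\triangleleft h_{(2)})=(b_{(0)}\triangleleft h_{(1)})\gamma(h_{(2)},gb_{(1)})$; and $b_{(0)}\gamma(hb_{(1)},g)=\gamma(h,g)b$. The action Hopf algebroid $\mathcal L=B\#H^{op}$ is the vector space $B\otimes H$ with product $(a\#h)(b\#g)=a(b\triangleleft h_{(1)})\#gh_{(2)}$, source $s(a)=a\#1$, target $t(a)=a_{(0)}\#a_{(1)}$, $B$-bimodule structure $b.X.c=s(b)t(c)X$, coproduct $\Delta(a\#h)=(a\#h_{(1)})\otimes_B(1\#h_{(2)})$ and counit $\varepsilon(a\#h)=a\varepsilon(h)$. It is a left bialgebroid (and left Hopf algebroid) over $B$; write $\Delta X=X_{(1)}\otimes_BX_{(2)}$. $\mathcal B_{ver}(\mathcal L)$ is the group of vertical left bisections: unital linear $\sigma:\mathcal L\to B$ with $\sigma(t(b)X)=\sigma(X)b$, $\sigma\circ s=\mathrm{id}_B$, $\sigma(XY)=\sigma(Xt(\sigma(Y)))=\sigma(Xs(\sigma(Y)))$, with product $(\sigma\ast\eta)(X)=\sigma(s(\eta(X_{(1)}))X_{(2)})$; $op$ denotes the opposite group. $C^1(\mathcal L,B)$ is the group, under convolution $(f\star g)(X)=f(X_{(1)})g(X_{(2)})$ with unit $\varepsilon$, of convolution-invertible $B$-bimodule maps $U:\mathcal L\to B$ with $U(1)=1$ and $U(Xs(b))=U(Xt(b))$. Let $\mathcal L\otimes_{B^e}\mathcal L$ be the quotient by $Xs(a)t(b)\otimes Y=X\otimes s(a)t(b)Y$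 with $b.(X,Y).c=(s(b)t(c)X,Y)$. $Z^2(\mathcal L,B)$ is the set of $\Gamma\in{}_B\mathrm{Hom}_B(\mathcal L\otimes_{B^e}\mathcal L,B)$ invertible for $(f\star g)(X,Y)=f(X_{(1)},Y_{(1)})g(X_{(2)},Y_{(2)})$ (unit $\varepsilon(XY)$) with $\Gamma(X,s(\Gamma(Y_{(1)},Z_{(1)}))Y_{(2)}Z_{(2)})=\Gamma(s(\Gamma(X_{(1)},Y_{(1)}))X_{(2)}Y_{(2)},Z)$, $\Gamma(1,X)=\varepsilon(X)=\Gamma(X,1)$, $\Gamma(X,Ys(b))=\Gamma(X,Yt(b))$. $C^1(\mathcal L,B)$ acts on $Z^2(\mathcal L,B)$ by $\Gamma^U(X,Y)=U^{-1}(X_{(1)}t(U^{-1}(Y_{(1)})))\Gamma(X_{(2)},Y_{(2)})U(X_{(3)}Y_{(3)})$, and $\mathcal H^2(\mathcal L,B)$ is the set of orbits. *)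

(* Defs.v *)
From HB Require Import structures.
From mathcomp Require Import all_boot all_order all_algebra.
From mathcomp Require Import boolp classical_sets functions.

Set Implicit Arguments.
Unset Strict Implicit.
Unset Printing Implicit Defensive.

Import GRing.Theory.
Local Open Scope ring_scope.
Local Open Scope classical_set_scope.
Local Open Scope quotient_scope.

Reserved Notation "\tsum_ ( x , y <- t ) F"
  (at level 41, F at level 41, x name, y name,
   format "'[' \tsum_ ( x ,  y  <-  t ) '/  '  F ']'").
Reserved Notation "V \ox W" (at level 40, left associativity).

(** [tensor ra la] is the abelian group generated by the pairs [(v, w)],
    modulo biadditivity and [(ra v a, w) = (v, la a w)].  It is V ⊗_R W when
    [ra] and [la] are the right and left actions of a ring R. Elements are
    classes of finite lists of pairs; as -(v, w) = (-v, w), no formal negatives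
    are needed. *)

Section Tensor.
Variables (V W : zmodType) (A : Type) (ra : V -> A -> V) (la : A -> W -> W).

Inductive tensor_eq : seq (V * W) -> seq (V * W) -> Prop :=
| tensor_eq_perm s s' : perm_eq s s' -> tensor_eq s s'
| tensor_eq_sym s s' : tensor_eq s s' -> tensor_eq s' s
| tensor_eq_trans s s' s'' :
    tensor_eq s s' -> tensor_eq s' s'' -> tensor_eq s s''
| tensor_eq_cat s s' u u' :
    tensor_eq s s' -> tensor_eq u u' -> tensor_eq (s ++ u) (s' ++ u')
| tensor_eq_0l w : tensor_eq [:: (0, w)] [::]
| tensor_eq_Dl v v' w : tensor_eq [:: (v + v', w)] [:: (v, w); (v', w)]
| tensor_eq_Dr v w w' : tensor_eq [:: (v, w + w')] [:: (v, w); (v, w')]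
| tensor_eq_bal v a w : tensor_eq [:: (ra v a, w)] [:: (v, la a w)].

Definition tensor_eqb (s s' : seq (V * W)) : bool := `[< tensor_eq s s' >].

Lemma tensor_eqb_refl : reflexive tensor_eqb.
Proof. by move=> s; apply/asboolP/tensor_eq_perm. Qed.

Lemma tensor_eqb_sym : symmetric tensor_eqb.
Proof. by move=> s s'; apply/asboolP/asboolP; apply: tensor_eq_sym. Qed.

Lemma tensor_eqb_trans : transitive tensor_eqb.
Proof.
move=> s s' s'' /asboolP h /asboolP h'; apply/asboolP.
exact: tensor_eq_trans h h'.
Qed.

Canonical tensor_eqb_equiv :=
  EquivRel tensor_eqb tensor_eqb_refl tensor_eqb_sym tensor_eqb_trans.

Definition tensor := {eq_quot tensor_eqb}.
HB.instance Definition _ := Choice.on tensor.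
HB.instance Definition _ := EqQuotient.on tensor.

Lemma tensor_piP (s s' : seq (V * W)) :
  \pi_tensor s = \pi_tensor s' <-> tensor_eq s s'.
Proof. by split=> [/eqmodP/asboolP|h] //; apply/eqmodP/asboolP. Qed.

Definition pure (v : V) (w : W) : tensor := \pi_tensor [:: (v, w)].

Definition tensor_add (x y : tensor) : tensor := \pi_tensor (repr x ++ repr y).
Definition tensor_opp (x : tensor) : tensor :=
  \pi_tensor [seq (- p.1, p.2) | p <- repr x].

Lemma tensor_reprP (s : seq (V * W)) : tensor_eq (repr (\pi_tensor s)) s.
Proof. by apply/tensor_piP; rewrite reprK. Qed.

Lemma tensor_add_pi (s s' : seq (V * W)) :
  tensor_add (\pi_tensor s) (\pi_tensor s') = \pi_tensor (s ++ s').
Proof. by apply/tensor_piP; apply: tensor_eq_cat; apply: tensor_reprP. Qed.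

Lemma tensor_addA : associative tensor_add.
Proof.
move=> x y z; rewrite -[x]reprK -[y]reprK -[z]reprK.
rewrite (tensor_add_pi (repr x) (repr y)) (tensor_add_pi (repr y) (repr z)).
by rewrite (tensor_add_pi (repr x)) (tensor_add_pi _ (repr z)) catA.
Qed.

Lemma tensor_addC : commutative tensor_add.
Proof.
move=> x y; rewrite -[x]reprK -[y]reprK !tensor_add_pi.
by apply/tensor_piP; apply: tensor_eq_perm; rewrite perm_catC.
Qed.

Lemma tensor_add0 : left_id (\pi_tensor [::]) tensor_add.
Proof. by move=> x; rewrite -[x]reprK tensor_add_pi. Qed.

Lemma tensor_eq_opp (s : seq (V * W)) :
  tensor_eq ([seq (- p.1, p.2) | p <- s] ++ s) [::].
Proof.
elim: s => [|[v w] s IHs] /=; first exact: tensor_eq_perm.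
apply: (@tensor_eq_trans _ ([:: (- v, w); (v, w)] ++
         ([seq (- p.1, p.2) | p <- s] ++ s))).
  apply: tensor_eq_perm; rewrite /= perm_cons -cat1s catA -[_ :: _ ++ s]cat1s.
  by rewrite catA perm_cat2r perm_catC.
rewrite -[[::]]cats0; apply: tensor_eq_cat IHs.
apply: tensor_eq_trans (tensor_eq_0l w); apply: tensor_eq_sym.
by rewrite -(addNr v); apply: tensor_eq_Dl.
Qed.

Lemma tensor_addN : left_inverse (\pi_tensor [::]) tensor_opp tensor_add.
Proof.
move=> x; rewrite -{2}[x]reprK tensor_add_pi.
by apply/tensor_piP; apply: tensor_eq_opp.
Qed.

HB.instance Definition _ :=
  GRing.isZmodule.Build tensor tensor_addA tensor_addC tensor_add0 tensor_addN.

Lemma pureDl v v' w : pure (v + v') w = pure v w + pure v' w.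
Proof. rewrite [RHS]tensor_add_pi; by apply/tensor_piP; apply: tensor_eq_Dl. Qed.

Lemma pureDr v w w' : pure v (w + w') = pure v w + pure v w'.
Proof. rewrite [RHS]tensor_add_pi; by apply/tensor_piP; apply: tensor_eq_Dr. Qed.

Lemma pure_bal v a w : pure (ra v a) w = pure v (la a w).
Proof. by apply/tensor_piP; apply: tensor_eq_bal. Qed.

(** [tensor_lift F t] is [\sum_i F v_i w_i] for a chosen expression
    [t = \sum_i v_i ⊗ w_i]; by [tensor_lift_pi] the choice is irrelevant
    when [F] is balanced. *)
Definition tensor_lift (U : zmodType) (F : V -> W -> U) (t : tensor) : U :=
  \sum_(p <- repr t) F p.1 p.2.

Definition balanced (U : zmodType) (F : V -> W -> U) : Prop :=
  [/\ forall v v' w, F (v + v') w = F v w + F v' w,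
      forall v w w', F v (w + w') = F v w + F v w'
    & forall v a w, F (ra v a) w = F v (la a w)].

Section Lift.
Variables (U : zmodType) (F : V -> W -> U).
Hypothesis balF : balanced F.

Lemma tensor_eq_sum (s s' : seq (V * W)) : tensor_eq s s' ->
  \sum_(p <- s) F p.1 p.2 = \sum_(p <- s') F p.1 p.2.
Proof.
case: balF => FDl FDr Fbal; elim => //= {s s'}.
- by move=> s s' h; apply: perm_big.
- by move=> s s' s'' _ -> _ ->.
- by move=> s s' u u' _ IH _ IH'; rewrite !big_cat IH IH'.
- move=> w; rewrite big_seq1 big_nil /=.
  by apply: (addrI (F 0 w)); rewrite -FDl !addr0.
- by move=> v v' w; rewrite !big_cons !big_nil /= !addr0 FDl.
- by move=> v w w'; rewrite !big_cons !big_nil /= !addr0 FDr.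
- by move=> v a w; rewrite !big_seq1 /= Fbal.
Qed.

Lemma tensor_lift_pi (s : seq (V * W)) :
  tensor_lift F (\pi_tensor s) = \sum_(p <- s) F p.1 p.2.
Proof. exact/tensor_eq_sum/tensor_reprP. Qed.

Lemma tensor_lift_pure v w : tensor_lift F (pure v w) = F v w.
Proof. by rewrite tensor_lift_pi big_seq1. Qed.

Lemma tensor_liftD (x y : tensor) :
  tensor_lift F (x + y) = tensor_lift F x + tensor_lift F y.
Proof. by rewrite tensor_lift_pi big_cat. Qed.

Lemma tensor_lift0 : tensor_lift F 0 = 0.
Proof.
by apply: (addrI (tensor_lift F 0)); rewrite -tensor_liftD !addr0.
Qed.

End Lift.

Lemma tensor_lift_add (U : zmodType) (F G : V -> W -> U) (t : tensor) :
  tensor_lift (fun v w => F v w + G v w) t = tensor_lift F t + tensor_lift G t.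
Proof. exact: big_split. Qed.

Lemma eq_tensor_lift (U : zmodType) (F G : V -> W -> U) (t : tensor) :
  (forall v w, F v w = G v w) -> tensor_lift F t = tensor_lift G t.
Proof. by move=> eqFG; apply: eq_bigr => p _. Qed.

End Tensor.

Notation "\tsum_ ( x , y <- t ) F" := (tensor_lift (fun x y => F) t)
  : ring_scope.

Section TensorField.
Variables (k : fieldType) (V W : lmodType k).

Definition ktensor :=
  tensor (fun (v : V) (c : k) => c *: v) (fun (c : k) (w : W) => c *: w).
HB.instance Definition _ := GRing.Zmodule.on ktensor.

Definition kpure (v : V) (w : W) : ktensor := pure _ _ v w.

Definition ktensor_scale (c : k) (x : ktensor) : ktensor :=
  tensor_lift (fun v w => kpure (c *: v) w) x.

Lemma kpureDl v v' w : kpure (v + v') w = kpure v w + kpure v' w.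
Proof. exact: pureDl. Qed.

Lemma kpureDr v w w' : kpure v (w + w') = kpure v w + kpure v w'.
Proof. exact: pureDr. Qed.

Lemma kpure_bal c v w : kpure (c *: v) w = kpure v (c *: w).
Proof. exact: (pure_bal _ _ v c w). Qed.

Let scale_bal c :
  balanced (fun (v : V) (c : k) => c *: v) (fun (c : k) (w : W) => c *: w)
    (fun v w => kpure (c *: v) w).
Proof.
split=> [v v' w|v w w'|v a w]; first by rewrite scalerDr kpureDl.
  by rewrite kpureDr.
by rewrite scalerA mulrC -scalerA kpure_bal.
Qed.

Lemma ktensor_scale_pure c v w :
  ktensor_scale c (kpure v w) = kpure (c *: v) w.
Proof. exact: tensor_lift_pure. Qed.

Let ktensor_scaleDr : right_distributive ktensor_scale +%R.
Proof. by move=> c x y; rewrite /ktensor_scale tensor_liftD. Qed.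

Lemma ktensor_ind (P : ktensor -> Prop) :
  P 0 -> (forall v w, P (kpure v w)) -> (forall x y, P x -> P y -> P (x + y)) ->
  forall x, P x.
Proof.
move=> P0 Pp PD x; rewrite -[x]reprK; elim: (repr x) => [|[v w] s IHs] //.
have -> : \pi_ktensor ((v, w) :: s) = kpure v w + \pi_ktensor s.
  by rewrite [RHS]tensor_add_pi.
exact: PD.
Qed.

Let ktensor_scale0 c : ktensor_scale c 0 = 0.
Proof. by apply: (addrI (ktensor_scale c 0)); rewrite -ktensor_scaleDr !addr0. Qed.

Let ktensor_scaleA c d x :
  ktensor_scale c (ktensor_scale d x) = ktensor_scale (c * d) x.
Proof.
elim/ktensor_ind: x => [|v w|x y IHx IHy]; first by rewrite !ktensor_scale0.
  by rewrite !ktensor_scale_pure scalerA.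
by rewrite !ktensor_scaleDr IHx IHy.
Qed.

Let ktensor_scale1 : left_id 1 ktensor_scale.
Proof.
elim/ktensor_ind => [|v w|x y IHx IHy]; first by rewrite ktensor_scale0.
  by rewrite ktensor_scale_pure scale1r.
by rewrite ktensor_scaleDr IHx IHy.
Qed.

Let ktensor_scaleDl x : {morph ktensor_scale^~ x : c d / c + d}.
Proof.
move=> c d; elim/ktensor_ind: x => [|v w|x y IHx IHy].
- by rewrite !ktensor_scale0 addr0.
- by rewrite !ktensor_scale_pure scalerDl kpureDl.
- by rewrite !ktensor_scaleDr IHx IHy addrACA.
Qed.

HB.instance Definition _ := GRing.Zmodule_isLmodule.Build k ktensor
  ktensor_scaleA ktensor_scale1 ktensor_scaleDr ktensor_scaleDl.

Definition kbalanced (U : zmodType) (F : V -> W -> U) : Prop :=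
  balanced (fun (v : V) (c : k) => c *: v) (fun (c : k) (w : W) => c *: w) F.

Lemma ktensor_liftZ (U : zmodType) (F : V -> W -> U) c (x : ktensor) :
  kbalanced F ->
  tensor_lift F (c *: x) = tensor_lift (fun v w => F (c *: v) w) x.
Proof.
move=> balF; have balG : kbalanced (fun v w => F (c *: v) w).
  case: balF => FDl FDr Fbal; split=> [v v' w|v w w'|v d w].
  - by rewrite scalerDr FDl.
  - by rewrite FDr.
  - by rewrite scalerA mulrC -scalerA Fbal.
elim/ktensor_ind: x => [|v w|x y IHx IHy].
- by rewrite scaler0 (tensor_lift0 balF) (tensor_lift0 balG).
- rewrite [_ *: _]ktensor_scale_pure.
  by rewrite (tensor_lift_pure balF) (tensor_lift_pure balG).
- by rewrite scalerDr (tensor_liftD balF) (tensor_liftD balG) IHx IHy.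
Qed.

End TensorField.

Notation "V \ox W" := (ktensor V W) : type_scope.
Notation "v \ox w" := (kpure v w) : ring_scope.

Section Groups.
Variables (T : Type) (G : set T) (op : T -> T -> T) (e : T).

Record is_group : Prop := IsGroup {
  is_groupM : forall x y, G x -> G y -> G (op x y);
  is_group1 : G e;
  is_groupA : forall x y z, G x -> G y -> G z -> op x (op y z) = op (op x y) z;
  is_group1m : forall x, G x -> op e x = x;
  is_groupm1 : forall x, G x -> op x e = x;
  is_groupV : forall x, G x -> exists2 y, G y & op x y = e /\ op y x = e
}.

Record is_right_action (X : Type) (S : set X) (act : X -> T -> X) : Prop :=
  IsRightAction {
    is_act_in : forall x g, S x -> G g -> S (act x g);
    is_act1 : forall x, S x -> act x e = x;
    is_actM : forall x g h, S x -> G g -> G h ->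
      act x (op g h) = act (act x g) h
  }.

Definition orbits (X : Type) (S : set X) (act : X -> T -> X) : set (set X) :=
  [set [set act x g | g in G] | x in S].

End Groups.

Definition is_subgroup (T : Type) (K G : set T) (op : T -> T -> T) (e : T) :=
  K `<=` G /\ is_group K op e.

Definition group_isomorphic (T T' : Type) (G : set T) (op : T -> T -> T)
    (G' : set T') (op' : T' -> T' -> T') : Prop :=
  exists f : T -> T', set_bij G G' f /\
    forall x y, G x -> G y -> f (op x y) = op' (f x) (f y).

Definition opposite (T : Type) (op : T -> T -> T) : T -> T -> T :=
  fun x y => op y x.

(** Two-sided inverses in the monoid [(M, op, e)]; [inverse] returns [e] on
    non-invertible elements. *)
Section Inverse.
Variables (T : choiceType) (M : set T) (op : T -> T -> T) (e : T).

Definition is_inverse (x y : T) : Prop := [/\ M y, op x y = e & op y x = e].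
Definition invertible (x : T) : Prop := exists y, is_inverse x y.
Definition inverse (x : T) : T := xget e [set y | is_inverse x y].

End Inverse.

Record hopf_algebra (k : fieldType) (H : algType k) := HopfAlgebra {
  comul : {linear H -> (H \ox H)%type};
  counit : {scalar H};
  antipode : {linear H -> H};
  comulA : forall h,
    \tsum_(t, h3 <- comul h) \tsum_(h1, h2 <- comul t) h1 \ox (h2 \ox h3) =
    \tsum_(h1, t <- comul h) \tsum_(h2, h3 <- comul t) h1 \ox (h2 \ox h3);
  counitl : forall h, \tsum_(h1, h2 <- comul h) (counit h1 *: h2) = h;
  counitr : forall h, \tsum_(h1, h2 <- comul h) (counit h2 *: h1) = h;
  comul1 : comul 1 = 1 \ox 1;
  comulM : forall h g, comul (h * g) =
    \tsum_(h1, h2 <- comul h) \tsum_(g1, g2 <- comul g) (h1 * g1) \ox (h2 * g2);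
  counit1 : counit 1 = 1;
  counitM : forall h g, counit (h * g) = counit h * counit g;
  antipodel : forall h,
    \tsum_(h1, h2 <- comul h) (antipode h1 * h2) = (counit h)%:A;
  antipoder : forall h,
    \tsum_(h1, h2 <- comul h) (h1 * antipode h2) = (counit h)%:A
}.

Section Sweedler.
Variables (k : fieldType) (H : algType k) (S : hopf_algebra H) (U : zmodType).

Definition sw2 (h : H) (F : H -> H -> U) : U :=
  \tsum_(h1, h2 <- comul S h) F h1 h2.
Definition sw3 (h : H) (F : H -> H -> H -> U) : U :=
  \tsum_(h1, t <- comul S h) sw2 t (F h1).
Definition sw4 (h : H) (F : H -> H -> H -> H -> U) : U :=
  \tsum_(h1, t <- comul S h) sw3 t (F h1).

Lemma sw2D h h' (F : H -> H -> U) :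
  kbalanced F -> sw2 (h + h') F = sw2 h F + sw2 h' F.
Proof. by move=> balF; rewrite /sw2 linearD (tensor_liftD balF). Qed.

Lemma sw2Z c h (F : H -> H -> U) :
  kbalanced F -> sw2 (c *: h) F = sw2 h (fun h1 h2 => F (c *: h1) h2).
Proof. by move=> balF; rewrite /sw2 linearZ (ktensor_liftZ c _ balF). Qed.

Lemma sw2_add h (F G : H -> H -> U) :
  sw2 h (fun h1 h2 => F h1 h2 + G h1 h2) = sw2 h F + sw2 h G.
Proof. exact: tensor_lift_add. Qed.

Lemma eq_sw2 h (F G : H -> H -> U) :
  (forall h1 h2, F h1 h2 = G h1 h2) -> sw2 h F = sw2 h G.
Proof. exact: eq_tensor_lift. Qed.

End Sweedler.
Arguments sw2 {k H} S {U}.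
Arguments sw3 {k H} S {U}.
Arguments sw4 {k H} S {U}.

Record dy_module (k : fieldType) (H : algType k) (S : hopf_algebra H)
    (B : lmodType k) := DYModule {
  act : B -> H -> B;
  coact : {linear B -> (B \ox H)%type};
  act_linearl : forall h, linear (act^~ h);
  act_linearr : forall b, linear (act b);
  act1 : forall b, act b 1 = b;
  actM : forall b h g, act b (h * g) = act (act b h) g;
  coactA : forall b,
    \tsum_(c, b2 <- coact b) \tsum_(b0, b1 <- coact c) b0 \ox (b1 \ox b2) =
    \tsum_(b0, t <- coact b) \tsum_(b1, b2 <- comul S t) b0 \ox (b1 \ox b2);
  coact_counit : forall b, \tsum_(b0, b1 <- coact b) (counit S b1 *: b0) = b;
  dy_compat : forall b h,
    \tsum_(h1, h2 <- comul S h)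
      \tsum_(c0, c1 <- coact (act b h2)) c0 \ox (h1 * c1) =
    \tsum_(b0, b1 <- coact b)
      \tsum_(h1, h2 <- comul S h) (act b0 h1) \ox (b1 * h2)
}.

Record braided_commutative (k : fieldType) (H : algType k)
    (S : hopf_algebra H) (B : algType k) (D : dy_module S B) : Prop :=
  BraidedCommutative {
    act_unit : forall h, act D 1 h = (counit S h)%:A;
    act_mul : forall a b h, act D (a * b) h =
      \tsum_(h1, h2 <- comul S h) (act D a h1 * act D b h2);
    coact_unit : coact D 1 = 1 \ox 1;
    coact_mul : forall a b, coact D (a * b) =
      \tsum_(a0, a1 <- coact D a)
        \tsum_(b0, b1 <- coact D b) (a0 * b0) \ox (a1 * b1);
    braided_comm : forall a b,
      a * b = \tsum_(b0, b1 <- coact D b) (b0 * act D a b1)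
  }.

Section HopfCohomology.
Variables (k : fieldType) (H : algType k) (S : hopf_algebra H).
Variables (B : algType k) (D : dy_module S B).
Local Notation "b <| h" := (act D b h) (at level 35).
Local Notation eps := (counit S).

Definition conv (f g : H -> B) : H -> B :=
  fun h => sw2 S h (fun h1 h2 => f h1 * g h2).
Definition conv1 : H -> B := fun h => (eps h)%:A.
Definition linear_maps : set (H -> B) := [set f | linear f].
Definition convV (f : H -> B) : H -> B := inverse linear_maps conv conv1 f.

Definition C1_ver : set (H -> B) := [set rho : H -> B |
  [/\ linear rho, invertible linear_maps conv conv1 rho, rho 1 = 1,
      forall h b,
        \tsum_(b0, b1 <- coact D b) (b0 * rho (h * b1)) = rho h * b
    & forall h b, sw2 S h (fun h1 h2 => rho h1 * (b <| h2)) =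
                  sw2 S h (fun h1 h2 => (b <| h1) * rho h2)]].

Definition conv2 (f g : (H \ox H)%type -> B) : (H \ox H)%type -> B :=
  fun x => \tsum_(h, h' <- x)
    sw2 S h (fun h1 h2 => sw2 S h' (fun h1' h2' =>
      f (h1 \ox h1') * g (h2 \ox h2'))).
Definition conv2_1 : (H \ox H)%type -> B :=
  fun x => \tsum_(h, h' <- x) (eps h * eps h')%:A.
Definition linear_maps2 : set ((H \ox H)%type -> B) := [set f | linear f].

Definition Z2 : set ((H \ox H)%type -> B) :=
  [set gamma : (H \ox H)%type -> B |
  [/\ linear gamma, invertible linear_maps2 conv2 conv2_1 gamma,
      forall h, gamma (h \ox 1) = (eps h)%:A /\ gamma (1 \ox h) = (eps h)%:A
    & [/\ forall f g h,
        sw2 S f (fun f1 f2 => sw2 S g (fun g1 g2 => sw2 S h (fun h1 h2 =>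
          (gamma (g1 \ox f1) <| h1) * gamma (h2 \ox (f2 * g2))))) =
        sw2 S g (fun g1 g2 => sw2 S h (fun h1 h2 =>
          gamma (h1 \ox g1) * gamma ((g2 * h2) \ox f))),
      forall g h b,
        sw2 S g (fun g1 g2 => sw2 S h (fun h1 h2 =>
          gamma (h1 \ox g1) * (b <| (g2 * h2)))) =
        sw2 S g (fun g1 g2 => sw2 S h (fun h1 h2 =>
          (b <| (g1 * h1)) * gamma (h2 \ox g2))),
      forall g h b,
        sw2 S h (fun h1 h2 => gamma (h1 \ox g) * (b <| h2)) =
        \tsum_(b0, b1 <- coact D b)
          sw2 S h (fun h1 h2 => (b0 <| h1) * gamma (h2 \ox (g * b1)))
    & forall g h b,
        \tsum_(b0, b1 <- coact D b) (b0 * gamma ((h * b1) \ox g)) =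
        gamma (h \ox g) * b]]].

Definition coboundary (rho : H -> B) : (H \ox H)%type -> B :=
  fun x => \tsum_(h, g <- x)
    sw3 S h (fun h1 h2 h3 => sw2 S g (fun g1 g2 =>
      convV rho h1 * (convV rho g1 <| h2) * rho (g2 * h3))).

Definition Z1_ver : set (H -> B) := [set rho |
  C1_ver rho /\ forall h g, coboundary rho (h \ox g) = (eps h * eps g)%:A].

Definition gauge (gamma : (H \ox H)%type -> B) (rho : H -> B) :
    (H \ox H)%type -> B :=
  fun x => \tsum_(h, g <- x)
    sw4 S h (fun h1 h2 h3 h4 => sw3 S g (fun g1 g2 g3 =>
      convV rho h1 * (convV rho g1 <| h2) * gamma (h3 \ox g2) *
      rho (g3 * h4))).

End HopfCohomology.
Arguments conv {k H} S {B}.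
Arguments conv1 {k H} S B.
Arguments convV {k H} S {B}.

(** The constructions below only involve the structure maps of a left
    bialgebroid over [B], which are gathered in [bialgebroid_data]. The
    bialgebroid axioms make every sum over a coproduct below independent of the
    chosen representative. *)

Record bialgebroid_data (k : fieldType) (B : algType k) := BialgebroidData {
  bgd_sort :> lmodType k;
  bmul : bgd_sort -> bgd_sort -> bgd_sort;
  bone : bgd_sort;
  src : B -> bgd_sort;
  tgt : B -> bgd_sort;
  bcomul : bgd_sort ->
    tensor (fun X b => bmul (tgt b) X) (fun b Y => bmul (src b) Y);
  bcounit : bgd_sort -> B
}.

Section Bialgebroid.
Variables (k : fieldType) (B : algType k) (L : bialgebroid_data B).
Local Notation "X ** Y" := (bmul X Y) (at level 40, left associativity).
Local Notation s := (src L).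
Local Notation t := (tgt L).
Local Notation eps := (@bcounit _ _ L).
Local Notation Delta := (@bcomul _ _ L).

Definition Bver : set (L -> B) := [set sigma : L -> B |
  [/\ linear sigma, sigma (bone L) = 1,
      forall b X, sigma (t b ** X) = sigma X * b,
      forall b, sigma (s b) = b
    & forall X Y, sigma (X ** Y) = sigma (X ** t (sigma Y)) /\
                  sigma (X ** Y) = sigma (X ** s (sigma Y))]].

Definition bis_mul (sigma eta : L -> B) : L -> B :=
  fun X => \tsum_(X1, X2 <- Delta X) sigma (s (eta X1) ** X2).

(** B-bimodule maps [L -> B], where [b.X.c = s(b)t(c)X]. *)
Definition bimod_maps : set (L -> B) := [set U : L -> B |
  linear U /\ forall b c X, U (s b ** t c ** X) = b * U X * c].

Definition bconv (f g : L -> B) : L -> B :=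
  fun X => \tsum_(X1, X2 <- Delta X) (f X1 * g X2).

Definition bconvV (U : L -> B) : L -> B := inverse bimod_maps bconv eps U.

Definition BC1 : set (L -> B) := [set U : L -> B |
  [/\ bimod_maps U, invertible bimod_maps bconv eps U, U (bone L) = 1
    & forall X b, U (X ** s b) = U (X ** t b)]].

(** [L ⊗_{B^e} L]; the scalar [(a, b)] acts through [s(a)t(b)]. *)
Definition tensorBe :=
  tensor (fun (X : L) (ab : B * B) => X ** s ab.1 ** t ab.2)
         (fun (ab : B * B) (Y : L) => s ab.1 ** t ab.2 ** Y).
HB.instance Definition _ := GRing.Zmodule.on tensorBe.

Definition pureBe (X Y : L) : tensorBe := pure _ _ X Y.

(** B-bimodule maps [L ⊗_{B^e} L -> B]; [k]-linearity follows from the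
    [B]-linearity. *)
Definition bimod_maps2 : set (tensorBe -> B) := [set Gamma : tensorBe -> B |
  {morph Gamma : x y / x + y} /\
  forall b c X Y,
    Gamma (pureBe (s b ** t c ** X) Y) = b * Gamma (pureBe X Y) * c].

Definition bconv2 (f g : tensorBe -> B) : tensorBe -> B :=
  fun x => \tsum_(X, Y <- x)
    \tsum_(X1, X2 <- Delta X) \tsum_(Y1, Y2 <- Delta Y)
      (f (pureBe X1 Y1) * g (pureBe X2 Y2)).
Definition bconv2_1 : tensorBe -> B := fun x => \tsum_(X, Y <- x) eps (X ** Y).

Definition BZ2 : set (tensorBe -> B) := [set Gamma : tensorBe -> B |
  [/\ bimod_maps2 Gamma, invertible bimod_maps2 bconv2 bconv2_1 Gamma,
      forall X Y Z,
        \tsum_(Y1, Y2 <- Delta Y) \tsum_(Z1, Z2 <- Delta Z)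
          Gamma (pureBe X (s (Gamma (pureBe Y1 Z1)) ** Y2 ** Z2)) =
        \tsum_(X1, X2 <- Delta X) \tsum_(Y1, Y2 <- Delta Y)
          Gamma (pureBe (s (Gamma (pureBe X1 Y1)) ** X2 ** Y2) Z),
      forall X, Gamma (pureBe (bone L) X) = eps X /\
                Gamma (pureBe X (bone L)) = eps X
    & forall X Y b, Gamma (pureBe X (Y ** s b)) = Gamma (pureBe X (Y ** t b))]].

Definition bgauge (Gamma : tensorBe -> B) (U : L -> B) : tensorBe -> B :=
  fun x => \tsum_(X, Y <- x)
    \tsum_(X1, X' <- Delta X) \tsum_(X2, X3 <- Delta X')
    \tsum_(Y1, Y' <- Delta Y) \tsum_(Y2, Y3 <- Delta Y')
      (bconvV U (X1 ** t (bconvV U Y1)) * Gamma (pureBe X2 Y2) * U (X3 ** Y3)).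

Definition BH2 : set (set (tensorBe -> B)) := orbits BC1 BZ2 bgauge.

End Bialgebroid.

Definition H2_act (k : fieldType) (H : algType k) (S : hopf_algebra H)
    (B : algType k) (D : dy_module S B) : set (set ((H \ox H)%type -> B)) :=
  orbits (C1_ver D) (Z2 D) (gauge D).

Section Smash.
Variables (k : fieldType) (H : algType k) (S : hopf_algebra H).
Variables (B : algType k) (D : dy_module S B).
Local Notation L := (B \ox H)%type.

Definition smash_mul (X Y : L) : L :=
  \tsum_(a, h <- X) \tsum_(b, g <- Y)
    sw2 S h (fun h1 h2 => (a * act D b h1) \ox (g * h2)).
Definition smash_one : L := 1 \ox 1.
Definition smash_src (a : B) : L := a \ox 1.
Definition smash_tgt (a : B) : L := coact D a.
Definition smash_comul (X : L) :
    tensor (fun X b => smash_mul (smash_tgt b) X)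
           (fun b Y => smash_mul (smash_src b) Y) :=
  \tsum_(a, h <- X) sw2 S h (fun h1 h2 => pure _ _ (a \ox h1) (1 \ox h2)).
Definition smash_counit (X : L) : B := \tsum_(a, h <- X) (counit S h *: a).

Definition smash : bialgebroid_data B :=
  @BialgebroidData k B L smash_mul smash_one smash_src smash_tgt
    smash_comul smash_counit.

Let actDl h a b : act D (a + b) h = act D a h + act D b h.
Proof. by have := act_linearl D h 1 a b; rewrite !scale1r. Qed.

Let actDr a h g : act D a (h + g) = act D a h + act D a g.
Proof. by have := act_linearr D a 1 h g; rewrite !scale1r. Qed.

Let act0l h : act D 0 h = 0.
Proof. by apply: (addrI (act D 0 h)); rewrite -actDl !addr0. Qed.

Let act0r a : act D a 0 = 0.
Proof. by apply: (addrI (act D a 0)); rewrite -actDr !addr0. Qed.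

Let actZl c h a : act D (c *: a) h = c *: act D a h.
Proof. by have := act_linearl D h c a 0; rewrite act0l !addr0. Qed.

Let actZr c h a : act D a (c *: h) = c *: act D a h.
Proof. by have := act_linearr D a c h 0; rewrite act0r !addr0. Qed.

Let mul_bal (a b : B) (g : H) :
  kbalanced (fun h1 h2 => (a * act D b h1) \ox (g * h2)).
Proof.
split=> [h h' h2|h1 h h'|h1 c h2].
- by rewrite actDr mulrDr kpureDl.
- by rewrite mulrDr kpureDr.
- by rewrite actZr -!scalerAr kpure_bal.
Qed.

Let smash_mul_bal2 (a : B) (h : H) : kbalanced (fun (b : B) (g : H) =>
  sw2 S h (fun h1 h2 => (a * act D b h1) \ox (g * h2))).
Proof.
split=> [b b' g|b g g'|b c g].
- by rewrite -sw2_add; apply: eq_sw2 => h1 h2; rewrite actDl mulrDr kpureDl.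
- by rewrite -sw2_add; apply: eq_sw2 => h1 h2; rewrite mulrDl kpureDr.
- by apply: eq_sw2 => h1 h2; rewrite actZl -scalerAr -scalerAl kpure_bal.
Qed.

Let smash_mul_bal1 (Y : L) : kbalanced (fun (a : B) (h : H) => \tsum_(b, g <- Y)
  sw2 S h (fun h1 h2 => (a * act D b h1) \ox (g * h2))).
Proof.
split=> [a a' h|a h h'|a c h].
- rewrite -tensor_lift_add; apply: eq_tensor_lift => b g.
  by rewrite -sw2_add; apply: eq_sw2 => h1 h2; rewrite mulrDl kpureDl.
- rewrite -tensor_lift_add; apply: eq_tensor_lift => b g.
  exact: sw2D (mul_bal _ _ _).
- apply: eq_tensor_lift => b g; rewrite (sw2Z _ _ _ (mul_bal a b g)).
  by apply: eq_sw2 => h1 h2; rewrite actZr -scalerAl -scalerAr.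
Qed.

Lemma smash_mul_pure a h b g : smash_mul (a \ox h) (b \ox g) =
  sw2 S h (fun h1 h2 => (a * act D b h1) \ox (g * h2)).
Proof.
rewrite /smash_mul (tensor_lift_pure (smash_mul_bal1 _)).
exact: tensor_lift_pure (smash_mul_bal2 _ _) _ _.
Qed.

Lemma smash_counit_pure a h : smash_counit (a \ox h) = counit S h *: a.
Proof.
apply: tensor_lift_pure; split=> [b b' g|b g g'|b c g].
- by rewrite scalerDr.
- by rewrite raddfD scalerDl.
- by rewrite scalarZ scalerA mulrC.
Qed.

Hypothesis hB : braided_commutative D.

Let src_scale c (X : L) : smash_mul (smash_src c%:A) X = c *: X.
Proof.
elim/ktensor_ind: X => [|a h|X Y IHX IHY].
- rewrite /smash_mul (tensor_lift_pure (smash_mul_bal1 _)) scaler0.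
  exact: tensor_lift0 (smash_mul_bal2 _ _).
- rewrite smash_mul_pure /sw2 comul1 (tensor_lift_pure (mul_bal _ _ _)).
  by rewrite act1 mulr1 -scalerAl mul1r [RHS]ktensor_scale_pure.
- rewrite /smash_mul !(tensor_lift_pure (smash_mul_bal1 _)) in IHX IHY *.
  by rewrite (tensor_liftD (smash_mul_bal2 _ _)) IHX IHY scalerDr.
Qed.

Let tgt_src c : smash_tgt c%:A = smash_src c%:A.
Proof.
by rewrite /smash_tgt linearZ (coact_unit hB) [LHS]ktensor_scale_pure.
Qed.

Let comul_bal a : kbalanced (fun h1 h2 : H => pure
  (fun X b => smash_mul (smash_tgt b) X) (fun b Y => smash_mul (smash_src b) Y)
  (a \ox h1) (1 \ox h2)).
Proof.
split=> [h h' g|h g g'|h c g]; first by rewrite kpureDr pureDl.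
  by rewrite kpureDr pureDr.
rewrite -[a \ox (c *: h)]kpure_bal -[1 \ox (c *: g)]kpure_bal.
rewrite -[(c *: a) \ox h]ktensor_scale_pure -[(c *: 1) \ox g]ktensor_scale_pure.
rewrite -[ktensor_scale c _]src_scale -[ktensor_scale c (1 \ox g)]src_scale.
by rewrite -{1}tgt_src pure_bal.
Qed.

Lemma smash_comul_pure a h : smash_comul (a \ox h) =
  sw2 S h (fun h1 h2 => pure _ _ (a \ox h1) (1 \ox h2)).
Proof.
apply: tensor_lift_pure; split=> [b b' g|b g g'|b c g].
- by rewrite -sw2_add; apply: eq_sw2 => h1 h2; rewrite kpureDl pureDl.
- exact: sw2D (comul_bal _).
- rewrite (sw2Z _ _ _ (comul_bal b)).
  by apply: eq_sw2 => h1 h2; rewrite kpure_bal.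
Qed.

End Smash.

(* Main.v *)
Require Import Defs.
From HB Require Import structures.
From mathcomp Require Import all_boot all_order all_algebra.
From mathcomp Require Import boolp classical_sets functions.

Set Implicit Arguments.
Unset Strict Implicit.
Unset Printing Implicit Defensive.

Import GRing.Theory.
Local Open Scope ring_scope.
Local Open Scope classical_set_scope.

(** Write [γ(h, g)] for a 2-cochain. All formulas of the theorem are words in
    iterated convolution algebras. For an algebra [A] let [C A] be the algebra
    of linear maps [H -> A] under convolution, so that 1-cochains live in
    [C B], 2-cochains in [C (C B)] and the cocycle identity in [C (C (C B))].
    There are four kinds of algebra maps between these: constants
    [const : A -> C A], post-composition [push phi : C A -> C A'] with an
    algebra map [phi], the pull-back [opmul : C A -> C (C A)] along the opposite
    product, [f |-> (g |-> h |-> f (g h))], and the action [alpha : B -> C B],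
    [b |-> (h |-> b <| h)]. The coboundary of [r] is then
    [const r^-1 * push alpha r^-1 * opmul r], the cocycle condition reads
    [push (push alpha) c * opmul c = const c * push opmul c], and that gauge
    transforms of cocycles are cocycles ([cocycle_gauge]) is a cancellation in
    a noncommutative ring: it uses the cosimplicial identities between the four
    maps and the two commutation conditions on [r] and [c], which let
    neighbouring factors be exchanged.

    The conditions involving the coaction all have the form
    [f h * phi b = phi b_(0) * f (h b_(1))] for an algebra map [phi : B -> A]
    ([twisted]). They pass to products and inverses since the coaction is
    coassociative and the coproduct multiplicative; the Drinfeld-Yetter
    compatibility turns them into a statement on the
    acting elements ([mul_push_action]), and braided commutativity says that
    [alpha b] itself satisfies them.

    The smash product is brought in by extending a cochain [f : H -> A] to
    [ext phi f (a # h) = phi a * f h]. The twisted cochains are exactly those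
    whose extension is [B]-linear for source and target ([extP]), the
    extension turns sums over the bialgebroid coproduct into convolution
    products ([ext_comul]), and it turns the product of the smash product into
    [opmul] ([ext_mul]). A 2-cochain of the Hopf algebroid is an extension of
    an extension: [(X, Y)] is sent to the extension at [X] of the 1-cochain
    [ext alpha c Y]. With these rules every condition and operation for the
    Hopf algebroid becomes the corresponding word in the convolution algebras,
    so groups, actions and orbits on the two sides are images of one and the
    same structure ([transport_group], [transport_action],
    [transport_orbits]).

    The antipode enters in the identification of vertical bisections: a
    vertical bisection satisfies the multiplicativity that makes the
    corresponding 1-cochain a 1-cocycle, but its convolution invertibility has
    to be produced, one side with [S] and the other with [S^-1]
    ([has_inv_opmul]). *)

(** * Sums over tensors *)

Section TensorSums.
Variables (V W : zmodType) (A : Type) (ra : V -> A -> V) (la : A -> W -> W).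
Implicit Types t : tensor ra la.

Lemma tsum_pure t : \tsum_(v, w <- t) pure ra la v w = t.
Proof.
rewrite -[RHS]reprK /tensor_lift; elim: (repr t) => [|[v w] s IHs].
  by rewrite big_nil.
by rewrite big_cons IHs [LHS]tensor_add_pi.
Qed.

Lemma tsum_exchange (V' W' : zmodType) (A' : Type) (ra' : V' -> A' -> V')
    (la' : A' -> W' -> W') (U : zmodType) t (t' : tensor ra' la')
    (F : V -> W -> V' -> W' -> U) :
  \tsum_(v, w <- t) \tsum_(v', w' <- t') F v w v' w' =
  \tsum_(v', w' <- t') \tsum_(v, w <- t) F v w v' w'.
Proof. exact: exchange_big. Qed.

Lemma additive_tsum (U U' : zmodType) (f : U -> U') t (F : V -> W -> U) :
  {morph f : x y / x + y} ->
  f (\tsum_(v, w <- t) F v w) = \tsum_(v, w <- t) f (F v w).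
Proof.
move=> fD; apply: (big_morph f fD).
by apply: (addrI (f 0)); rewrite -fD !addr0.
Qed.

Lemma mulr_tsumr (B : pzRingType) (b : B) t (F : V -> W -> B) :
  b * (\tsum_(v, w <- t) F v w) = \tsum_(v, w <- t) (b * F v w).
Proof. exact: mulr_sumr. Qed.

Lemma mulr_tsuml (B : pzRingType) (b : B) t (F : V -> W -> B) :
  (\tsum_(v, w <- t) F v w) * b = \tsum_(v, w <- t) (F v w * b).
Proof. exact: mulr_suml. Qed.

Lemma scaler_tsum (R : pzRingType) (U : lmodType R) (c : R) t
    (F : V -> W -> U) :
  c *: (\tsum_(v, w <- t) F v w) = \tsum_(v, w <- t) (c *: F v w).
Proof. exact: scaler_sumr. Qed.

End TensorSums.

Section TensorSumsBalanced.
Variables (V W : zmodType) (A : Type) (ra : V -> A -> V) (la : A -> W -> W).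
Implicit Types t : tensor ra la.

(** [tensor_lift] reads off one chosen representative of its tensor; balance
    makes that choice irrelevant, hence compatible with sums of tensors. *)
Lemma tsum_tsum (U V' W' : zmodType) (A' : Type) (ra' : V' -> A' -> V')
    (la' : A' -> W' -> W') (t' : tensor ra' la') (F : V -> W -> U)
    (G : V' -> W' -> tensor ra la) :
  balanced ra la F ->
  \tsum_(v, w <- \tsum_(v', w' <- t') G v' w') F v w =
  \tsum_(v', w' <- t') \tsum_(v, w <- G v' w') F v w.
Proof.
move=> balF; apply: (@additive_tsum _ _ _ _ _ _ _ (fun t => tensor_lift F t)).
exact: tensor_liftD.
Qed.

Lemma tensor_additiveE (U : zmodType) (f : tensor ra la -> U) t :
  {morph f : x y / x + y} -> f t = \tsum_(v, w <- t) f (pure ra la v w).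
Proof. by move=> fD; rewrite -(additive_tsum _ _ fD) tsum_pure. Qed.

End TensorSumsBalanced.

Section Bilinear.
Variables (k : fieldType) (V W U : lmodType k).

Lemma bilinear_kbalanced (F : V -> W -> U) :
  (forall w, linear (F^~ w)) -> (forall v, linear (F v)) -> kbalanced F.
Proof.
move=> Fl Fr.
have Fl0 w : F 0 w = 0.
  by have := Fl w (-1) 0 0; rewrite /= scaler0 addr0 scaleN1r addNr.
have Fr0 v : F v 0 = 0.
  by have := Fr v (-1) 0 0; rewrite /= scaler0 addr0 scaleN1r addNr.
split=> [v v' w|v w w'|v c w].
- by have := Fl w 1 v v'; rewrite !scale1r.
- by have := Fr v 1 w w'; rewrite !scale1r.
- by have := Fl w c v 0; have := Fr v c w 0; rewrite Fl0 Fr0 !addr0 => -> ->.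
Qed.

Lemma kbalanced_Z (F : V -> W -> U) : (forall w, linear (F^~ w)) ->
  (forall v, linear (F v)) ->
  forall c (t : (V \ox W)%type),
  \tsum_(v, w <- c *: t) F v w = c *: (\tsum_(v, w <- t) F v w).
Proof.
move=> Fl Fr c t; rewrite (ktensor_liftZ _ _ (bilinear_kbalanced Fl Fr)).
rewrite scaler_tsum; apply: eq_tensor_lift => v w.
have Fl0 : F 0 w = 0.
  by have := Fl w (-1) 0 0; rewrite /= scaler0 addr0 scaleN1r addNr.
by have := Fl w c v 0; rewrite Fl0 !addr0.
Qed.

End Bilinear.

Lemma scaler_kpure (k : fieldType) (V W : lmodType k) (c : k) (v : V) (w : W) :
  c *: (v \ox w) = (c *: v) \ox w.
Proof. exact: ktensor_scale_pure. Qed.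

Section TripleTensor.
Variables (k : fieldType) (V W Z T T' : lmodType k).
Variables (u : (T \ox Z)%type) (d : T -> (V \ox W)%type).
Variables (u' : (V \ox T')%type) (d' : T' -> (W \ox Z)%type).

(** Coassociativity laws are stated in [V ⊗ (W ⊗ Z)]; they are used by
    evaluating a trilinear function on both sides. The two balance
    hypotheses together amount to trilinearity. *)
Lemma tsumA (U : zmodType) (F : V -> W -> Z -> U) :
  (forall z, kbalanced (fun x y => F x y z)) ->
  (forall x, kbalanced (F x)) ->
  \tsum_(t, z <- u) \tsum_(x, y <- d t) x \ox (y \ox z) =
  \tsum_(x, t <- u') \tsum_(y, z <- d' t) x \ox (y \ox z) ->
  \tsum_(t, z <- u) \tsum_(x, y <- d t) F x y z =
  \tsum_(x, t <- u') \tsum_(y, z <- d' t) F x y z.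
Proof.
move=> balxy balyz.
pose G (x : V) (p : (W \ox Z)%type) := \tsum_(y, z <- p) F x y z.
have balG : kbalanced G.
  split=> [x x' p|x p p'|x c p].
  - rewrite -tensor_lift_add; apply: eq_tensor_lift => y z.
    by have [] := balxy z.
  - exact: (tensor_liftD (balyz x)).
  - rewrite /G (ktensor_liftZ _ _ (balyz x)); apply: eq_tensor_lift => y z.
    by have [_ _] := balxy z; apply.
move/(congr1 (fun T => \tsum_(x, p <- T) G x p)).
rewrite (tsum_tsum _ _ balG); under eq_tensor_lift => t z.
  rewrite (tsum_tsum _ _ balG).
  under eq_tensor_lift => x y.
    rewrite (tensor_lift_pure balG) /G (tensor_lift_pure (balyz x)); over.
  over.
move=> ->; rewrite (tsum_tsum _ _ balG); apply: eq_tensor_lift => x t.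
rewrite (tsum_tsum _ _ balG); apply: eq_tensor_lift => y z.
by rewrite (tensor_lift_pure balG) /G (tensor_lift_pure (balyz x)).
Qed.

End TripleTensor.

(** * Sweedler sums *)

(** Makes the lemmas on bundled linear maps available for a function whose
    linearity is only a hypothesis. *)
Definition pack_linear (k : fieldType) (U U' : lmodType k) (f : U -> U')
    (flin : linear f) : {linear U -> U'} :=
  HB.pack f (GRing.isLinear.Build k U U' *:%R f flin).

Lemma linear_morphD (k : fieldType) (U U' : lmodType k) (f : U -> U') :
  linear f -> {morph f : x y / x + y}.
Proof. by move=> flin; apply: (linearD (pack_linear flin)). Qed.

Section SweedlerSums.
Variables (k : fieldType) (H : algType k) (S : hopf_algebra H).
Implicit Types (h g : H).

Lemma linear_tsum (V W : zmodType) (T : Type) (ra : V -> T -> V)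
    (la : T -> W -> W) (U U' : lmodType k) (f : {linear U -> U'})
    (t : tensor ra la) (F : V -> W -> U) :
  f (\tsum_(v, w <- t) F v w) = \tsum_(v, w <- t) f (F v w).
Proof. exact: raddf_sum. Qed.

Lemma linear_sw2 (U U' : lmodType k) (f : {linear U -> U'}) h
    (F : H -> H -> U) :
  f (sw2 S h F) = sw2 S h (fun h1 h2 => f (F h1 h2)).
Proof. exact: raddf_sum. Qed.

Lemma mulr_sw2r (B : pzRingType) (b : B) h (F : H -> H -> B) :
  b * sw2 S h F = sw2 S h (fun h1 h2 => b * F h1 h2).
Proof. exact: mulr_tsumr. Qed.

Lemma mulr_sw2l (B : pzRingType) (b : B) h (F : H -> H -> B) :
  sw2 S h F * b = sw2 S h (fun h1 h2 => F h1 h2 * b).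
Proof. exact: mulr_tsuml. Qed.

Lemma scaler_sw2 (U : lmodType k) (c : k) h (F : H -> H -> U) :
  c *: sw2 S h F = sw2 S h (fun h1 h2 => c *: F h1 h2).
Proof. exact: scaler_tsum. Qed.

Lemma sw2A (U : zmodType) h (F : H -> H -> H -> U) :
  (forall z, kbalanced (fun x y => F x y z)) ->
  (forall x, kbalanced (F x)) ->
  sw2 S h (fun t z => sw2 S t (fun x y => F x y z)) =
  sw2 S h (fun x t => sw2 S t (fun y z => F x y z)).
Proof. by move=> balxy balyz; apply: tsumA; last exact: comulA. Qed.

Lemma sw2_1 (U : zmodType) (F : H -> H -> U) :
  kbalanced F -> sw2 S 1 F = F 1 1.
Proof. by move=> balF; rewrite /sw2 comul1 (tensor_lift_pure balF). Qed.

Lemma sw2M (U : zmodType) h g (F : H -> H -> U) : kbalanced F ->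
  sw2 S (h * g) F =
  sw2 S h (fun h1 h2 => sw2 S g (fun g1 g2 => F (h1 * g1) (h2 * g2))).
Proof.
move=> balF; rewrite /sw2 comulM (tsum_tsum _ _ balF).
apply: eq_tensor_lift => h1 h2; rewrite (tsum_tsum _ _ balF).
by apply: eq_tensor_lift => g1 g2; rewrite (tensor_lift_pure balF).
Qed.

Lemma sw2_linear (U : lmodType k) (F : H -> H -> U) :
  (forall w, linear (F^~ w)) -> (forall v, linear (F v)) ->
  linear (fun h => sw2 S h F).
Proof.
move=> Fl Fr c h h'; have balF := bilinear_kbalanced Fl Fr.
by rewrite (sw2D _ _ _ balF) /sw2 linearZ (kbalanced_Z Fl Fr).
Qed.

Lemma sw2_counitl (U : lmodType k) h (f : H -> U) : linear f ->
  sw2 S h (fun h1 h2 => counit S h1 *: f h2) = f h.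
Proof.
move=> flin; pose g := pack_linear flin; rewrite -[RHS]/(g h) -{2}(counitl S h).
by rewrite linear_sw2; apply: eq_sw2 => h1 h2; rewrite linearZ.
Qed.

Lemma sw2_counitr (U : lmodType k) h (f : H -> U) : linear f ->
  sw2 S h (fun h1 h2 => counit S h2 *: f h1) = f h.
Proof.
move=> flin; pose g := pack_linear flin; rewrite -[RHS]/(g h) -{2}(counitr S h).
by rewrite linear_sw2; apply: eq_sw2 => h1 h2; rewrite linearZ.
Qed.

End SweedlerSums.

(** * Convolution algebras *)

(** [S] is a parameter of the type so that the convolution product can be
    inferred from it. *)
Record cochain (k : fieldType) (H : algType k) (S : hopf_algebra H)
    (A : algType k) := Cochain { cfun :> H -> A; cfunP : linear cfun }.

HB.instance Definition _ (k : fieldType) (H : algType k) (S : hopf_algebra H)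
  (A : algType k) (f : cochain S A) :=
  GRing.isLinear.Build k H A *:%R (cfun f) (cfunP f).

Section CochainAlgebra.
Variables (k : fieldType) (H : algType k) (S : hopf_algebra H) (A : algType k).
Local Notation cochain := (cochain S A).
Local Notation eps := (counit S).
Implicit Types (f g : cochain) (h : H).

Lemma cochainP f g : (forall h, f h = g h) -> f = g.
Proof.
case: f g => [f fP] [g gP] /= /funext fg.
by case: g / fg gP => gP; congr Cochain; apply: Prop_irrelevance.
Qed.

HB.instance Definition _ := gen_eqMixin cochain.
HB.instance Definition _ := gen_choiceMixin cochain.

Fact cochain_add_linear f g : linear (fun h => f h + g h).
Proof. by move=> c h h'; rewrite !linearP scalerDr addrACA. Qed.
Fact cochain_opp_linear f : linear (fun h => - f h).
Proof. by move=> c h h'; rewrite linearP opprD scalerN. Qed.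
Fact cochain_zero_linear : linear (fun h => 0 : A).
Proof. by move=> c h h'; rewrite scaler0 addr0. Qed.
Fact cochain_scale_linear c f : linear (fun h => c *: f h).
Proof. by move=> d h h'; rewrite linearP scalerDr !scalerA mulrC. Qed.
Fact cochain_mul_linear f g :
  linear (fun h => sw2 S h (fun h1 h2 => f h1 * g h2)).
Proof.
apply: sw2_linear => [y|x] c z z'; first by rewrite linearP mulrDl scalerAl.
by rewrite linearP mulrDr scalerAr.
Qed.
Fact cochain_one_linear : linear (fun h => (eps h)%:A : A).
Proof. by move=> c h h'; rewrite linearP scalerDl -scalerA. Qed.

Definition cochain_add f g := Cochain S (cochain_add_linear f g).
Definition cochain_opp f := Cochain S (cochain_opp_linear f).
Definition cochain_zero := Cochain S cochain_zero_linear.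
Definition cochain_scale c f := Cochain S (cochain_scale_linear c f).
Definition cochain_mul f g := Cochain S (cochain_mul_linear f g).
Definition cochain_one := Cochain S cochain_one_linear.

Fact cochain_addA : associative cochain_add.
Proof. by move=> f g e; apply: cochainP => h /=; rewrite addrA. Qed.
Fact cochain_addC : commutative cochain_add.
Proof. by move=> f g; apply: cochainP => h /=; rewrite addrC. Qed.
Fact cochain_add0 : left_id cochain_zero cochain_add.
Proof. by move=> f; apply: cochainP => h /=; rewrite add0r. Qed.
Fact cochain_addN : left_inverse cochain_zero cochain_opp cochain_add.
Proof. by move=> f; apply: cochainP => h /=; rewrite addNr. Qed.

HB.instance Definition _ := GRing.isZmodule.Build cochain
  cochain_addA cochain_addC cochain_add0 cochain_addN.

Fact cochain_mulA : associative cochain_mul.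
Proof.
move=> f g e; apply: cochainP => h /=.
under eq_sw2 => h1 h2 do rewrite mulr_sw2r.
under [RHS]eq_sw2 => h1 h2 do rewrite mulr_sw2l.
rewrite [RHS]sw2A.
- by apply: eq_sw2 => h1 h2; apply: eq_sw2 => h3 h4; rewrite mulrA.
- move=> z; apply: bilinear_kbalanced => [y|x] c u v /=.
    by rewrite linearP !mulrDl -!scalerAl.
  by rewrite linearP mulrDr mulrDl -scalerAr -scalerAl.
- move=> x; apply: bilinear_kbalanced => [z|y] c u v /=.
    by rewrite linearP mulrDr mulrDl -scalerAr -scalerAl.
  by rewrite linearP mulrDr -scalerAr.
Qed.
Fact cochain_mul1r : left_id cochain_one cochain_mul.
Proof.
move=> f; apply: cochainP => h /=.
under eq_sw2 => h1 h2 do rewrite mulr_algl.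
exact: sw2_counitl (cfunP f).
Qed.
Fact cochain_mulr1 : right_id cochain_one cochain_mul.
Proof.
move=> f; apply: cochainP => h /=.
under eq_sw2 => h1 h2 do rewrite mulr_algr.
exact: sw2_counitr (cfunP f).
Qed.
Fact cochain_mulDl : left_distributive cochain_mul +%R.
Proof.
move=> f g e; apply: cochainP => h /=; rewrite -sw2_add.
by apply: eq_sw2 => h1 h2; rewrite mulrDl.
Qed.
Fact cochain_mulDr : right_distributive cochain_mul +%R.
Proof.
move=> f g e; apply: cochainP => h /=; rewrite -sw2_add.
by apply: eq_sw2 => h1 h2; rewrite mulrDr.
Qed.
Fact cochain_one_neq0 : cochain_one != 0.
Proof.
apply/eqP => /(congr1 (fun f : cochain => f 1)) /=.
by rewrite counit1 scale1r => /eqP; rewrite oner_eq0.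
Qed.

HB.instance Definition _ := GRing.Zmodule_isNzRing.Build cochain
  cochain_mulA cochain_mul1r cochain_mulr1 cochain_mulDl cochain_mulDr
  cochain_one_neq0.

Fact cochain_scaleA c d f :
  cochain_scale c (cochain_scale d f) = cochain_scale (c * d) f.
Proof. by apply: cochainP => h /=; rewrite scalerA. Qed.
Fact cochain_scale1 : left_id 1 cochain_scale.
Proof. by move=> f; apply: cochainP => h /=; rewrite scale1r. Qed.
Fact cochain_scaleDr : right_distributive cochain_scale +%R.
Proof. by move=> c f g; apply: cochainP => h /=; rewrite scalerDr. Qed.
Fact cochain_scaleDl f : {morph cochain_scale^~ f : c d / c + d}.
Proof. by move=> c d; apply: cochainP => h /=; rewrite scalerDl. Qed.

HB.instance Definition _ := GRing.Zmodule_isLmodule.Build k cochain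
  cochain_scaleA cochain_scale1 cochain_scaleDr cochain_scaleDl.

Fact cochain_scaleAl c f g : c *: (f * g) = (c *: f) * g.
Proof.
apply: cochainP => h; rewrite /= scaler_sw2.
by apply: eq_sw2 => h1 h2; rewrite scalerAl.
Qed.
HB.instance Definition _ :=
  GRing.Lmodule_isLalgebra.Build k cochain cochain_scaleAl.

Fact cochain_scaleAr c f g : c *: (f * g) = f * (c *: g).
Proof.
apply: cochainP => h; rewrite /= scaler_sw2.
by apply: eq_sw2 => h1 h2; rewrite scalerAr.
Qed.
HB.instance Definition _ :=
  GRing.Lalgebra_isAlgebra.Build k cochain cochain_scaleAr.

Lemma cochainM f g h : (f * g) h = sw2 S h (fun h1 h2 => f h1 * g h2).
Proof. by []. Qed.
Lemma cochainD f g h : (f + g) h = f h + g h.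
Proof. by []. Qed.
Lemma cochainZ c f h : (c *: f) h = c *: f h.
Proof. by []. Qed.
Lemma cochain1 h : (1 : cochain) h = (eps h)%:A.
Proof. by []. Qed.

Lemma tsum_cochain (V W : zmodType) (T : Type) (ra : V -> T -> V)
    (la : T -> W -> W) (t : tensor ra la) (F : V -> W -> cochain) h :
  (\tsum_(v, w <- t) F v w) h = \tsum_(v, w <- t) (F v w h).
Proof. exact: (@additive_tsum _ _ _ _ _ _ _ (fun f : cochain => f h)). Qed.

Lemma sw2_cochain h (F : H -> H -> cochain) x :
  (sw2 S h F) x = sw2 S h (fun h1 h2 => F h1 h2 x).
Proof. exact: tsum_cochain. Qed.

End CochainAlgebra.

(** * Algebra maps between convolution algebras *)

Section Push.
Variables (k : fieldType) (H : algType k) (S : hopf_algebra H).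
Variables (A A' : algType k).

Fact push_linear (phi : {linear A -> A'}) (f : cochain S A) :
  linear (fun h => phi (f h)).
Proof. by move=> c h h'; rewrite !linearP. Qed.

Definition push (phi : {linear A -> A'}) (f : cochain S A) : cochain S A' :=
  Cochain S (push_linear phi f).

Fact push_is_linear phi : linear (push phi).
Proof. by move=> c f g; apply: cochainP => h; rewrite /= linearP. Qed.
HB.instance Definition _ phi :=
  GRing.isLinear.Build k (cochain S A) (cochain S A') *:%R (push phi)
    (push_is_linear phi).

Fact push_is_monoid_morphism (phi : {lrmorphism A -> A'}) :
  monoid_morphism (push phi).
Proof.
split=> [|f g]; apply: cochainP => h /=.
  by rewrite linearZ /= rmorph1.
rewrite linear_sw2.
by apply: eq_sw2 => h1 h2; rewrite rmorphM.
Qed.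
HB.instance Definition _ (phi : {lrmorphism A -> A'}) :=
  GRing.isMonoidMorphism.Build (cochain S A) (cochain S A') (push phi)
    (push_is_monoid_morphism phi).

Lemma pushE phi (f : cochain S A) h : push phi f h = phi (f h).
Proof. by []. Qed.

End Push.
Arguments push {k H S A A'}.

Section Coface.
Variables (k : fieldType) (H : algType k) (S : hopf_algebra H) (A : algType k).
Implicit Types (a : A) (f g : cochain S A).

Fact const_linear a : linear (fun h => counit S h *: a).
Proof. by move=> c h h'; rewrite linearP scalerDl scalerA. Qed.
(** The unit map of the convolution algebra; it inserts a [counit]. *)
Definition const a : cochain S A := Cochain S (const_linear a).

Fact const_is_linear : linear const.
Proof.
move=> c a b; apply: cochainP => h /=.
by rewrite scalerDr !scalerA mulrC.
Qed.
HB.instance Definition _ :=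
  GRing.isLinear.Build k A (cochain S A) *:%R const const_is_linear.

Lemma constMl a f h : (const a * f) h = a * f h.
Proof.
rewrite cochainM -[f h](sw2_counitl S _ (cfunP f)) mulr_sw2r.
by apply: eq_sw2 => h1 h2; rewrite -scalerAl -scalerAr.
Qed.

Lemma constMr a f h : (f * const a) h = f h * a.
Proof.
rewrite cochainM -[f h](sw2_counitr S _ (cfunP f)) mulr_sw2l.
by apply: eq_sw2 => h1 h2; rewrite -scalerAl -scalerAr.
Qed.

Fact const_is_monoid_morphism : monoid_morphism const.
Proof.
split=> [|a b]; apply: cochainP => h //.
by rewrite constMl /= scalerAr.
Qed.
HB.instance Definition _ :=
  GRing.isMonoidMorphism.Build A (cochain S A) const const_is_monoid_morphism.

Fact opmul_linear (f : cochain S A) (g : H) : linear (fun h => f (g * h)).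
Proof. by move=> c h h'; rewrite mulrDr -scalerAr linearP. Qed.
Fact opmul_linear2 f : linear (fun x : H => Cochain S (opmul_linear f x)).
Proof.
by move=> c g g'; apply: cochainP => h; rewrite /= mulrDl -scalerAl linearP.
Qed.
(** For the order of arguments: a map [γ : H ⊗ H -> B] is stored as
    [c : H -> (H -> B)] with [c g h = γ(h, g)], so that [opmul r] stands for
    [γ(h, g) = r (g h)]. With the second argument of [γ] outermost, the coface
    [r (g) <| h] is just [push alpha r]. *)
Definition opmul f : cochain S (cochain S A) := Cochain S (opmul_linear2 f).

Fact opmul_is_linear : linear opmul.
Proof. by move=> c f g; apply: cochainP => h; apply: cochainP. Qed.
HB.instance Definition _ :=
  GRing.isLinear.Build k (cochain S A) (cochain S (cochain S A)) *:%R opmul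
    opmul_is_linear.

Lemma mul_kbalanced f g : kbalanced (fun h1 h2 => f h1 * g h2).
Proof.
apply: bilinear_kbalanced => [y|x] c u v /=.
  by rewrite linearP mulrDl scalerAl.
by rewrite linearP mulrDr scalerAr.
Qed.

Fact opmul_is_monoid_morphism : monoid_morphism opmul.
Proof.
split=> [|f g]; apply: cochainP => x; apply: cochainP => y /=.
  by rewrite counitM scalerA.
rewrite (sw2M S _ _ (mul_kbalanced f g)).
by rewrite sw2_cochain.
Qed.
HB.instance Definition _ :=
  GRing.isMonoidMorphism.Build (cochain S A) (cochain S (cochain S A)) opmul
    opmul_is_monoid_morphism.

Lemma opmulE f (g h : H) : opmul f g h = f (g * h).
Proof. by []. Qed.

Lemma commute_const f a :
  (forall h, f h * a = a * f h) -> f * const a = const a * f.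
Proof. by move=> fa; apply: cochainP => h; rewrite constMl constMr. Qed.

Fact at1_is_linear : linear (fun f => f 1).
Proof. by []. Qed.
Definition at1 (f : cochain S A) : A := f 1.
HB.instance Definition _ :=
  GRing.isLinear.Build k (cochain S A) A *:%R at1 at1_is_linear.
Fact at1_is_monoid_morphism : monoid_morphism at1.
Proof.
split=> [|f g]; first by rewrite /at1 cochain1 counit1 scale1r.
by rewrite /at1 cochainM (sw2_1 S (mul_kbalanced f g)).
Qed.
HB.instance Definition _ :=
  GRing.isMonoidMorphism.Build (cochain S A) A at1 at1_is_monoid_morphism.

End Coface.
Arguments const {k H} S {A}.
Arguments opmul {k H S A}.
Arguments at1 {k H S A} f : simpl never.

Section Cosimplicial.
Variables (k : fieldType) (H : algType k) (S : hopf_algebra H).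
Variables (A A' : algType k) (phi : {linear A -> A'}).

Lemma push_const (a : A) : push phi (const S a) = const S (phi a).
Proof. by apply: cochainP => h; rewrite /= linearZ. Qed.

Lemma push_opmul (f : cochain S A) :
  push (push phi) (opmul f) = opmul (push phi f).
Proof. by apply: cochainP => x; apply: cochainP. Qed.

(** This and the next lemma, with [push_const] and [push_opmul] above, are the
    cosimplicial identities between the cofaces. *)
Lemma opmul_const (a : A) : opmul (const S a) = const S (const S a).
Proof.
by apply: cochainP => x; apply: cochainP => y; rewrite /= counitM scalerA.
Qed.

Lemma opmulA (f : cochain S A) :
  push opmul (opmul f) = opmul (opmul f).
Proof.
apply: cochainP => x; apply: cochainP => y; apply: cochainP => z.
by rewrite /= mulrA.
Qed.

End Cosimplicial.

(** * The antipode *)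

Section Antipode.
Variables (k : fieldType) (H : algType k) (S : hopf_algebra H).

Lemma antipode1 : antipode S 1 = 1.
Proof.
have := antipodel S 1; rewrite -/(sw2 S 1 (fun h1 h2 => antipode S h1 * h2)).
rewrite (sw2_1 S (F := fun x y => antipode S x * y)).
  by rewrite mulr1 counit1 scale1r.
apply: bilinear_kbalanced => [y|x] c u v /=.
  by rewrite linearP mulrDl scalerAl.
by rewrite mulrDr scalerAr.
Qed.

(** Both sides are convolution inverse to the product [H ⊗ H -> H]. *)
Lemma antipodeM g h : antipode S (g * h) = antipode S h * antipode S g.
Proof.
have idlin : linear (@idfun H) by [].
pose i := Cochain S idlin; pose a := Cochain S (linearP (antipode S)).
have ia : i * a = 1 by apply: cochainP => x; apply: antipoder.
have ai : a * i = 1 by apply: cochainP => x; apply: antipodel.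
have mE : opmul i = push (const S) i * const S i.
  apply: cochainP => x; rewrite constMr.
  by apply: cochainP => y; rewrite constMl.
have left_inv : opmul a * opmul i = 1 by rewrite -rmorphM ai rmorph1.
have right_inv : opmul i * (const S a * push (const S) a) = 1.
  rewrite mE -mulrA [const S i * _]mulrA -rmorphM ia rmorph1 mul1r.
  by rewrite -rmorphM ia rmorph1.
have -> : antipode S (g * h) = opmul a g h by [].
rewrite -[opmul a]mulr1 -right_inv mulrA left_inv mul1r constMl.
by rewrite constMr.
Qed.

(** Because [S] reverses products, applying it to the left-hand side below
    gives the sum of [S h1 * h2]. *)
Lemma antipode_inverse : bijective (antipode S) ->
  exists2 T : H -> H, linear T &
    forall h, sw2 S h (fun h1 h2 => T h2 * h1) = (counit S h)%:A.
Proof.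
move=> [T ST TS]; exists T => [c x y|h].
  by apply: (can_inj ST); rewrite linearP !TS.
apply: (can_inj ST); rewrite linear_sw2 linearZ /= antipode1 -antipodel.
by apply: eq_sw2 => h1 h2; rewrite antipodeM TS.
Qed.

End Antipode.

(** * Twisted commutation with the coaction *)

(** [R] stands for right translation by elements of [H]. It is kept abstract
    because 2-cochains can be translated in either argument. *)
Section AbstractTwist.
Variables (k : fieldType) (H : algType k) (S : hopf_algebra H).
Variables (B : lmodType k) (D : dy_module S B).
Variables (E : algType k) (phi : {linear B -> E}) (R : H -> {linear E -> E}).
Hypothesis R_linear : forall f, linear (fun x => R x f).
Hypothesis RM : forall x f g,
  R x (f * g) = sw2 S x (fun x1 x2 => R x1 f * R x2 g).
Hypothesis R1 : forall x, R x 1 = counit S x *: 1.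

Definition twist (b : B) (f : E) : E :=
  \tsum_(b0, b1 <- coact D b) (phi b0 * R b1 f).

(** Moving [f] past [phi b0] applies the coaction a second time; by
    coassociativity the two translations recombine into that of [f * g]. *)
Lemma twist_mul f g b :
  (forall c, f * phi c = twist c f) -> f * twist b g = twist b (f * g).
Proof.
move=> ftw; rewrite /twist mulr_tsumr.
under eq_tensor_lift => c b2.
  rewrite mulrA ftw mulr_tsuml.
  under eq_tensor_lift => b0 b1 do rewrite -mulrA.
  over.
rewrite (tsumA _ _ (coactA D b)).
- apply: eq_tensor_lift => b0 t.
  by rewrite RM mulr_sw2r.
- move=> z; apply: bilinear_kbalanced => [y|x] c u v /=.
    by rewrite linearP mulrDl scalerAl.
  by rewrite R_linear mulrDl mulrDr -scalerAl -scalerAr.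
- move=> x; apply: bilinear_kbalanced => [z|y] c u v /=.
    by rewrite R_linear mulrDl mulrDr -scalerAl -scalerAr.
  by rewrite R_linear !mulrDr -!scalerAr.
Qed.

Lemma twist1 b : twist b 1 = phi b.
Proof.
rewrite -{2}(coact_counit D b) linear_tsum.
by apply: eq_tensor_lift => b0 b1; rewrite R1 linearZ -scalerAr mulr1.
Qed.

Lemma twistedM f g : (forall b, f * phi b = twist b f) ->
  (forall b, g * phi b = twist b g) ->
  forall b, f * g * phi b = twist b (f * g).
Proof. by move=> ftw gtw b; rewrite -mulrA gtw twist_mul. Qed.

(** [f * twist b f' = twist b 1 = phi b] by [twist_mul]; multiply by [f'] on the
    left. *)
Lemma twistedV f f' : f * f' = 1 -> f' * f = 1 ->
  (forall b, f * phi b = twist b f) -> forall b, f' * phi b = twist b f'.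
Proof.
move=> ff' f'f ftw b.
by rewrite -[RHS]mul1r -f'f -mulrA (twist_mul _ _ ftw) ff' twist1.
Qed.

End AbstractTwist.

Section Translate.
Variables (k : fieldType) (H : algType k) (S : hopf_algebra H) (A : algType k).
Implicit Types (f g : cochain S A) (x : H).

Fact translate_linear x f : linear (fun h => f (h * x)).
Proof. by move=> c h h'; rewrite mulrDl -scalerAl linearP. Qed.
Definition translate x f : cochain S A := Cochain S (translate_linear x f).
Fact translate_is_linear x : linear (translate x).
Proof. by move=> c f g; apply: cochainP. Qed.
HB.instance Definition _ x := GRing.isLinear.Build k (cochain S A) (cochain S A)
  *:%R (translate x) (translate_is_linear x).

Lemma translate_linearl f : linear (translate^~ f).
Proof.
by move=> c x y; apply: cochainP => h; rewrite /= mulrDr -scalerAr linearP.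
Qed.

Lemma translateM x f g : translate x (f * g) =
  sw2 S x (fun x1 x2 => translate x1 f * translate x2 g).
Proof.
apply: cochainP => h; rewrite sw2_cochain /= (sw2M S _ _ (mul_kbalanced f g)).
exact: tsum_exchange.
Qed.

Lemma translate1 x : translate x 1 = counit S x *: 1.
Proof.
by apply: cochainP => h; rewrite /= counitM mulrC scalerA.
Qed.

End Translate.
Arguments translate {k H S A}.

Section Twisted.
Variables (k : fieldType) (H : algType k) (S : hopf_algebra H).
Variables (B : lmodType k) (D : dy_module S B).

(** For [phi] the identity this is the coaction condition on 1-cochains. For
    [phi = alpha] and [A = C B] it is the condition on the second argument of
    a 2-cochain. *)
Definition twisted (A : algType k) (phi : B -> A) (f : cochain S A) : Prop :=
  forall h b,
    \tsum_(b0, b1 <- coact D b) (phi b0 * f (h * b1)) = f h * phi b.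

Lemma twistedE (A : algType k) (phi : {linear B -> A}) f :
  twisted phi f <->
  forall b, f * const S (phi b) =
    twist D (const S \o phi) translate b f.
Proof.
split=> ftw.
  move=> b; apply: cochainP => h; rewrite constMr -ftw tsum_cochain.
  by apply: eq_tensor_lift => b0 b1; rewrite constMl.
move=> h b; rewrite -constMr ftw tsum_cochain.
by apply: eq_tensor_lift => b0 b1; rewrite constMl.
Qed.

Section Closure.
Variables (A : algType k) (phi : {linear B -> A}).
Implicit Types f g : cochain S A.

Lemma twisted_mul f g : twisted phi f -> twisted phi g -> twisted phi (f * g).
Proof.
move=> /twistedE ftw /twistedE gtw; apply/twistedE.
apply: (twistedM (phi := const S \o phi) _ _ ftw gtw).
  exact: translate_linearl.
exact: translateM.
Qed.

Lemma twisted_inv f f' :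
  f * f' = 1 -> f' * f = 1 -> twisted phi f -> twisted phi f'.
Proof.
move=> ff' f'f /twistedE ftw; apply/twistedE.
apply: (twistedV (phi := const S \o phi) _ _ _ ff' f'f ftw).
- exact: translate_linearl.
- exact: translateM.
- exact: translate1.
Qed.

Lemma twisted1 : twisted phi 1.
Proof.
move=> h b; rewrite cochain1 mulr_algl -{2}(coact_counit D b).
rewrite linear_tsum scaler_tsum.
apply: eq_tensor_lift => b0 b1.
by rewrite linearZ cochain1 counitM scalerA mulr_algr.
Qed.

Lemma twistedD f g : twisted phi f -> twisted phi g -> twisted phi (f + g).
Proof.
move=> ftw gtw h b; rewrite cochainD mulrDl -ftw -gtw -tensor_lift_add.
by apply: eq_tensor_lift => b0 b1; rewrite cochainD mulrDr.
Qed.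

Lemma twistedZ c f : twisted phi f -> twisted phi (c *: f).
Proof.
move=> ftw h b; rewrite cochainZ -scalerAl -ftw scaler_tsum.
by apply: eq_tensor_lift => b0 b1; rewrite cochainZ -scalerAr.
Qed.

Lemma twisted0 : twisted phi 0.
Proof. by have := twistedZ 0 twisted1; rewrite scale0r. Qed.

Lemma twisted_sum (V W : zmodType) (T : Type) (ra : V -> T -> V)
    (la : T -> W -> W) (t : tensor ra la) (F : V -> W -> cochain S A) :
  (forall v w, twisted phi (F v w)) -> twisted phi (\tsum_(v, w <- t) F v w).
Proof.
move=> Ftw; rewrite /tensor_lift; apply: big_ind => //.
  exact: twisted0.
exact: twistedD.
Qed.

Lemma twisted_push (A' : algType k) (psi : {lrmorphism A -> A'}) f :
  twisted phi f -> twisted (psi \o phi) (push psi f).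
Proof.
move=> ftw h b; rewrite /= -rmorphM -ftw /=.
rewrite linear_tsum.
by apply: eq_tensor_lift => b0 b1; rewrite /= rmorphM.
Qed.

Lemma twisted_opmul f x : twisted phi f -> twisted phi (opmul f x).
Proof.
move=> ftw h b; rewrite /= -ftw.
by apply: eq_tensor_lift => b0 b1; rewrite /= mulrA.
Qed.

Lemma twisted_const a : (forall b, a * phi b = phi b * a) ->
  twisted phi (const S a).
Proof.
move=> aC h b; rewrite -{2}(coact_counit D b) linear_tsum.
rewrite mulr_tsumr; apply: eq_tensor_lift => b0 b1.
by rewrite linearZ /= counitM -!scalerAr -scalerAl scalerA mulrC aC.
Qed.

End Closure.
End Twisted.

Arguments twisted_const {k H S B D A phi a}.

(** * Inverses in a ring *)

Section RingInverse.
Variable A : nzRingType.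
Implicit Types x y : A.

Definition has_inv x : Prop := invertible [set: A] *%R 1 x.
Definition rinv x : A := inverse [set: A] *%R 1 x.

Lemma has_invP x y : x * y = 1 -> y * x = 1 -> has_inv x.
Proof. by move=> xy yx; exists y. Qed.

Lemma mulrinv x : has_inv x -> x * rinv x = 1.
Proof. by move=> /(xgetPex 1)[]. Qed.

Lemma mulinvr x : has_inv x -> rinv x * x = 1.
Proof. by move=> /(xgetPex 1)[]. Qed.

Lemma mul_cancel x y z : x * y = 1 -> x * (y * z) = z.
Proof. by move=> xy; rewrite mulrA xy mul1r. Qed.

Lemma rinv_unique x y y' : x * y = 1 -> y' * x = 1 -> y = y'.
Proof. by move=> xy y'x; rewrite -[y]mul1r -y'x -mulrA xy mulr1. Qed.

Lemma rinvE x y : x * y = 1 -> y * x = 1 -> rinv x = y.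
Proof.
move=> xy yx; exact: (rinv_unique (mulrinv (has_invP xy yx)) yx).
Qed.

Lemma has_inv1 : has_inv 1.
Proof. by apply: (@has_invP _ 1); rewrite mulr1. Qed.

Lemma rinv1 : rinv 1 = 1.
Proof. by apply: rinvE; rewrite mulr1. Qed.

Lemma has_inv_rinv x : has_inv x -> has_inv (rinv x).
Proof. by move=> ux; apply: has_invP (mulinvr ux) (mulrinv ux). Qed.

Lemma mulr_rinvK x y : has_inv x -> x * (rinv x * y) = y.
Proof. by move=> ux; apply/mul_cancel/mulrinv. Qed.

Lemma mulr_rinvVK x y : has_inv x -> rinv x * (x * y) = y.
Proof. by move=> ux; apply/mul_cancel/mulinvr. Qed.

Lemma has_invM x y : has_inv x -> has_inv y -> has_inv (x * y).
Proof.
move=> ux uy; apply: (@has_invP _ (rinv y * rinv x)).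
  by rewrite -mulrA mulr_rinvK // mulrinv.
by rewrite -mulrA mulr_rinvVK // mulinvr.
Qed.

Lemma rinvM x y : has_inv x -> has_inv y -> rinv (x * y) = rinv y * rinv x.
Proof.
move=> ux uy; apply: rinvE.
  by rewrite -mulrA mulr_rinvK // mulrinv.
by rewrite -mulrA mulr_rinvVK // mulinvr.
Qed.

Lemma commute_rinv x y : has_inv x -> x * y = y * x -> rinv x * y = y * rinv x.
Proof.
move=> ux xy; rewrite -[LHS]mulr1 -(mulrinv ux) mulrA -[_ * y * x]mulrA -xy.
by rewrite mulr_rinvVK.
Qed.

End RingInverse.

Section RingInverseMorphism.
Variables (A A' : nzRingType) (phi : {rmorphism A -> A'}).

Lemma has_inv_morph x : has_inv x -> has_inv (phi x).
Proof.
move=> ux; apply: (@has_invP _ _ (phi (rinv x))); rewrite -rmorphM /=.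
  by rewrite mulrinv // rmorph1.
by rewrite mulinvr // rmorph1.
Qed.

Lemma mulr_morph_inv x : has_inv x -> phi x * phi (rinv x) = 1.
Proof. by move=> ux; rewrite -rmorphM mulrinv ?rmorph1. Qed.

Lemma mul_morph_invr x : has_inv x -> phi (rinv x) * phi x = 1.
Proof. by move=> ux; rewrite -rmorphM mulinvr ?rmorph1. Qed.

End RingInverseMorphism.

Lemma twisted_rinv (k : fieldType) (H : algType k) (S : hopf_algebra H)
    (B : lmodType k) (D : dy_module S B) (A : algType k)
    (phi : {linear B -> A}) (f : cochain S A) :
  has_inv f -> twisted D phi f -> twisted D phi (rinv f).
Proof. by move=> uf; apply: twisted_inv; [apply: mulrinv|apply: mulinvr]. Qed.

(** * The gauge action on convolution cochains *)

Section Action.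
Variables (k : fieldType) (H : algType k) (S : hopf_algebra H).
Variables (B : algType k) (D : dy_module S B) (D_bc : braided_commutative D).
Local Notation "b <| h" := (act D b h) (at level 35).

(** The proof of braided commutativity is an argument because [alpha] is an
    algebra map only for a module algebra. *)
Definition action of braided_commutative D := fun b : B =>
  Cochain S (act_linearr D b).
Local Notation alpha := (action D_bc).

Fact action_is_linear : linear alpha.
Proof. by move=> c b b'; apply: cochainP => h; apply: act_linearl. Qed.
HB.instance Definition _ :=
  GRing.isLinear.Build k B (cochain S B) *:%R alpha action_is_linear.
Fact action_is_monoid_morphism : monoid_morphism alpha.
Proof.
split=> [|a b]; apply: cochainP => h; first exact: (act_unit D_bc).
exact: (act_mul D_bc).
Qed.
HB.instance Definition _ :=
  GRing.isMonoidMorphism.Build B (cochain S B) alpha action_is_monoid_morphism.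

(** Associativity of the action, as a relation between cofaces. *)
Lemma push_action b : push alpha (alpha b) = opmul (alpha b).
Proof.
by apply: cochainP => g; apply: cochainP => h; rewrite /= actM.
Qed.

Lemma push_push_action (r : cochain S B) :
  push (push alpha) (push alpha r) = push opmul (push alpha r).
Proof. by apply: cochainP => g; rewrite /= push_action. Qed.

(** Braided commutativity of [B] applied to [(b <| h) * c]. *)
Lemma twisted_action b : twisted D idfun (alpha b).
Proof.
move=> h c /=; rewrite (braided_comm D_bc).
by apply: eq_tensor_lift => c0 c1; rewrite actM.
Qed.

Lemma dy_sum (U : zmodType) (F : B -> H -> U) b h : kbalanced F ->
  \tsum_(b0, b1 <- coact D b) sw2 S h (fun h1 h2 => F (b0 <| h1) (b1 * h2)) =
  sw2 S h (fun h1 h2 => \tsum_(c0, c1 <- coact D (b <| h2)) F c0 (h1 * c1)).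
Proof.
move=> balF.
have := congr1 (fun t => \tsum_(x, y <- t) F x y) (dy_compat D b h).
rewrite (tsum_tsum _ _ balF) (tsum_tsum _ _ balF) /sw2 => dy.
transitivity (\tsum_(b0, b1 <- coact D b) \tsum_(x, y <-
    \tsum_(h1, h2 <- comul S h) (b0 <| h1) \ox (b1 * h2)) F x y).
  apply: eq_tensor_lift => b0 b1; rewrite (tsum_tsum _ _ balF).
  by apply: eq_tensor_lift => h1 h2; rewrite (tensor_lift_pure balF).
rewrite -dy; apply: eq_tensor_lift => h1 h2; rewrite (tsum_tsum _ _ balF).
by apply: eq_tensor_lift => c0 c1; rewrite (tensor_lift_pure balF).
Qed.

(** By the Drinfeld-Yetter compatibility, the right-hand side at [h] is a sum
    over the coaction of [b <| h2], to which the twisted condition applies. *)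
Lemma mul_push_action (A : algType k) (phi : {linear B -> A}) f b :
  twisted D phi f ->
  f * push phi (alpha b) =
  \tsum_(b0, b1 <- coact D b) (push phi (alpha b0) * opmul f b1).
Proof.
move=> ftw; apply: cochainP => h; rewrite tsum_cochain.
under [RHS]eq_tensor_lift => b0 b1 do rewrite cochainM /=.
rewrite (@dy_sum _ (fun x y => phi x * f y)).
  by apply: eq_sw2 => h1 h2; rewrite ftw.
apply: bilinear_kbalanced => [y|x] c u v /=.
  by rewrite linearP mulrDl scalerAl.
by rewrite linearP mulrDr scalerAr.
Qed.

Lemma twisted_action_opmul (r : cochain S B) :
  twisted D idfun r -> twisted D alpha (opmul r).
Proof.
move=> rtw g b; have := mul_push_action b (twisted_opmul g rtw).
have push_id c : push idfun (alpha c) = alpha c by exact: cochainP.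
rewrite push_id => ->; apply: eq_tensor_lift => b0 b1.
rewrite push_id; congr (_ * _); apply: cochainP => h /=.
by rewrite mulrA.
Qed.

Local Notation A1 := (cochain S B).
Local Notation A2 := (cochain S A1).
Implicit Types (r q : A1) (c : A2) (b : B) (g h : H).

Definition vertical r : Prop := forall b, r * alpha b = alpha b * r.

Definition cochain_C1 : set A1 := [set r |
  [/\ has_inv r, at1 r = 1, twisted D idfun r & vertical r]].

(** The conditions on the second and on the first argument of a 2-cochain that
    involve the coaction: together they say that its extension to the smash
    product is well defined and [B]-bilinear. *)
Definition bitwisted c : Prop :=
  twisted D alpha c /\ forall g, twisted D idfun (c g).

Definition cocycle c : Prop :=
  push (push alpha) c * opmul c = const S c * push opmul c.

(** The first two equations are the normalisations [γ(h, 1) = ε(h)] and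
    [γ(1, h) = ε(h)]. *)
Definition cochain_Z2 : set A2 := [set c |
  [/\ has_inv c, at1 c = 1 /\ push at1 c = 1, cocycle c,
      forall b, c * opmul (alpha b) = opmul (alpha b) * c & bitwisted c]].

Definition cochain_gauge c r : A2 :=
  const S (rinv r) * push alpha (rinv r) * c * opmul r.

Lemma vertical_inv r : has_inv r -> vertical r -> vertical (rinv r).
Proof. by move=> ur vr b; apply: commute_rinv. Qed.

Lemma cochain_C1_group : is_group cochain_C1 *%R 1.
Proof.
split.
- move=> r q [ur r1 rtw vr] [uq q1 qtw vq]; split.
  + exact: has_invM.
  + by rewrite rmorphM /= r1 q1 mulr1.
  + exact: twisted_mul.
  + by move=> b; rewrite -mulrA vq mulrA vr mulrA.
- split.
  + exact: has_inv1.
  + exact: rmorph1.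
  + exact: (twisted1 D idfun).
  + by move=> b; rewrite mul1r mulr1.
- by move=> x y z _ _ _; rewrite mulrA.
- by move=> x _; rewrite mul1r.
- by move=> x _; rewrite mulr1.
- move=> r [ur r1 rtw vr]; exists (rinv r); last first.
    by rewrite mulrinv // mulinvr.
  split.
  + exact: has_inv_rinv.
  + by rewrite -[LHS]mul1r -{1}r1 (mulr_morph_inv at1).
  + exact: (twisted_rinv (phi := idfun)).
  + exact: vertical_inv.
Qed.

Lemma cochain_C1_inv r : cochain_C1 r -> cochain_C1 (rinv r).
Proof.
move=> Cr; have [q Cq [rq qr]] := is_groupV cochain_C1_group Cr.
by rewrite (rinvE rq qr).
Qed.

Lemma bitwisted_mul c d : bitwisted c -> bitwisted d -> bitwisted (c * d).
Proof.
move=> [c3 c4] [d3 d4]; split; first exact: (twisted_mul (phi := alpha)).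
move=> g; rewrite cochainM.
by apply: (twisted_sum (phi := idfun)) => g1 g2; apply: twisted_mul.
Qed.

Lemma bitwisted_const r :
  twisted D idfun r -> vertical r -> bitwisted (const S r).
Proof.
move=> rtw vr; split; first exact: (twisted_const (phi := alpha)).
by move=> g; apply: (twistedZ (phi := idfun)).
Qed.

Lemma bitwisted_push r : twisted D idfun r -> bitwisted (push alpha r).
Proof.
move=> rtw; split; last by move=> g; apply: twisted_action.
exact: (twisted_push (phi := idfun) alpha).
Qed.

Lemma bitwisted_opmul r : twisted D idfun r -> bitwisted (opmul r).
Proof.
move=> rtw; split; first exact: twisted_action_opmul.
by move=> g; apply: (twisted_opmul (phi := idfun)).
Qed.

Lemma bitwisted1 : bitwisted 1.
Proof.
rewrite -(rmorph1 (const S)); apply: bitwisted_const.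
  exact: (twisted1 D idfun).
by move=> b; rewrite mul1r mulr1.
Qed.

(** The twisted condition in the inner argument holds for each [c g], but
    [rinv c] is not computed pointwise in [g]; so [twistedV] is used with
    translation of the inner argument. *)
Lemma bitwisted_inv c : has_inv c -> bitwisted c -> bitwisted (rinv c).
Proof.
move=> uc [c3 c4]; split.
  exact: (twisted_rinv (phi := alpha)).
pose phi : {linear B -> A2} := const S \o const S.
pose R (x : H) : {linear A2 -> A2} := push (translate x).
have twE (d : A2) : (forall g, twisted D idfun (d g)) <->
    forall b, d * phi b = twist D phi R b d.
  split=> dtw.
    move=> b; apply: cochainP => g; apply: cochainP => h.
    rewrite !constMr -(dtw g) /twist !tsum_cochain.
    by apply: eq_tensor_lift => b0 b1; rewrite !constMl.
  move=> g h b; rewrite -constMr -[d g * _]constMr dtw /twist !tsum_cochain.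
  by apply: eq_tensor_lift => b0 b1; rewrite !constMl.
apply/twE; apply: twistedV (mulrinv uc) (mulinvr uc) _; last exact/twE.
- by move=> f a x y; apply: cochainP => g; apply: translate_linearl.
- move=> x f f'; apply: cochainP => g.
  rewrite sw2_cochain /= linear_sw2.
  under eq_sw2 => g1 g2 do rewrite /= translateM.
  exact: tsum_exchange.
- move=> x; apply: cochainP => g.
  by rewrite /= linearZ /= translate1 scalerA mulrC -scalerA.
Qed.

Lemma cochain_Z2_1 : cochain_Z2 1.
Proof.
split.
- exact: has_inv1.
- by rewrite !rmorph1.
- by rewrite /cocycle !rmorph1.
- by move=> b; rewrite mul1r mulr1.
- exact: bitwisted1.
Qed.

End Action.

(** * Gauge transformations of cocycles *)

Section Gauge.
Variables (k : fieldType) (H : algType k) (S : hopf_algebra H).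
Variables (B : algType k) (D : dy_module S B) (D_bc : braided_commutative D).
Local Notation alpha := (action D_bc).
Local Notation A1 := (cochain S B).
Local Notation A2 := (cochain S A1).
Implicit Types (r q : A1) (c : A2) (b : B) (g h : H).

(** Verticality says that [r] commutes with the functions [h |-> b <| h], and
    these are the values of [push alpha q]. *)
Lemma push_action_const r q : vertical D_bc r ->
  push alpha q * const S r = const S r * push alpha q.
Proof. by move=> vr; apply: commute_const => g; rewrite vr. Qed.

(** In the left-hand word [V (h)] is moved to the front by verticality, and
    the middle factors [r (f g) <| h], [V (f g) <| h] cancel. In the right-hand
    word [r (g h)] and [V (g h)] cancel, and [c] is moved past [V (f) <| (g h)]
    by its commutation condition. What remains is the identity for [c]. *)
Lemma cocycle_gauge c r : cochain_C1 D_bc r ->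
  (forall b, c * opmul (alpha b) = opmul (alpha b) * c) ->
  cocycle D_bc c -> cocycle D_bc (cochain_gauge D_bc c r).
Proof.
move=> [ur _ _ vr] cC cc; have vV := vertical_inv ur vr.
rewrite /cocycle /cochain_gauge; set V := rinv r in vV *.
have e0C y : push (push alpha) y * const S (const S V) =
    const S (const S V) * push (push alpha) y.
  by apply: commute_const => f; apply: commute_const => g; rewrite vV.
have cP : const S c * push opmul (push alpha V) =
    push opmul (push alpha V) * const S c.
  by apply/esym/commute_const => f; rewrite cC.
have rV : opmul (push alpha r) * opmul (push alpha V) = 1.
  by rewrite -!rmorphM mulrinv // !rmorph1.
have rV' : const S (opmul r) * const S (opmul V) = 1.
  by rewrite -!rmorphM mulrinv // !rmorph1.
rewrite !(rmorphM opmul) /= opmul_const !mulrA e0C.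
rewrite !rmorphM /= !push_const push_opmul push_push_action opmulA.
rewrite -!mulrA; do 2 congr (_ * _).
rewrite (mul_cancel _ rV) (mul_cancel _ rV') !mulrA cP.
by rewrite -!mulrA; congr (_ * _); rewrite !mulrA cc.
Qed.

Lemma gauge_commute c r : cochain_C1 D_bc r ->
  (forall b, c * opmul (alpha b) = opmul (alpha b) * c) ->
  forall b, cochain_gauge D_bc c r * opmul (alpha b) =
            opmul (alpha b) * cochain_gauge D_bc c r.
Proof.
move=> [ur _ _ vr] cC b; have vV := vertical_inv ur vr.
have rC : opmul r * opmul (alpha b) = opmul (alpha b) * opmul r.
  by rewrite -!rmorphM vr.
have pC : push alpha (rinv r) * opmul (alpha b) =
    opmul (alpha b) * push alpha (rinv r).
  by rewrite -(push_action D_bc) -!(rmorphM (push alpha)) vV.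
have sC : const S (rinv r) * opmul (alpha b) =
    opmul (alpha b) * const S (rinv r).
  apply/esym/commute_const => g; rewrite -(push_action D_bc).
  by rewrite vV.
apply/esym; rewrite /cochain_gauge.
by apply: GRing.commrM; [apply: GRing.commrM; [apply: GRing.commrM|]|];
  apply: esym.
Qed.

Lemma bitwisted_gauge c r :
  cochain_C1 D_bc r -> bitwisted D_bc c ->
  bitwisted D_bc (cochain_gauge D_bc c r).
Proof.
move=> Cr ctw; have [ur _ rtw vr] := Cr.
have [_ _ Vtw vV] := cochain_C1_inv Cr.
apply: bitwisted_mul; [apply: bitwisted_mul; [apply: bitwisted_mul|]|] => //.
- exact: bitwisted_const.
- exact: bitwisted_push.
- exact: bitwisted_opmul.
Qed.

Lemma gauge_in c r : cochain_Z2 D_bc c -> cochain_C1 D_bc r ->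
  cochain_Z2 D_bc (cochain_gauge D_bc c r).
Proof.
move=> [uc [c1 c1'] cc cC ctw] Cr; have [ur r1 rtw vr] := Cr.
have [uV V1 _ _] := cochain_C1_inv Cr.
split.
- apply: has_invM; last exact: (has_inv_morph opmul).
  apply: has_invM => //; apply: has_invM.
    exact: (has_inv_morph (const S)).
  exact: (has_inv_morph (push alpha)).
- split.
    rewrite /cochain_gauge !rmorphM /= c1 mulr1.
    have -> : at1 (const S (rinv r)) = rinv r.
      by rewrite /at1 /= counit1 scale1r.
    have -> : at1 (opmul r) = r.
      by apply: cochainP => h; rewrite /at1 opmulE mul1r.
    have -> : at1 (push alpha (rinv r)) = 1.
      by rewrite /at1 pushE [rinv r 1]V1 rmorph1.
    by rewrite mulr1 mulinvr.
  rewrite /cochain_gauge !rmorphM /= c1' mulr1 push_const /= V1 rmorph1 mul1r.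
  have -> : push at1 (push alpha (rinv r)) = rinv r.
    by apply: cochainP => h; apply: act1.
  have -> : push at1 (opmul r) = r.
    by apply: cochainP => h; rewrite /= /at1 opmulE mulr1.
  by rewrite mulinvr.
- exact: cocycle_gauge.
- exact: gauge_commute.
- exact: bitwisted_gauge.
Qed.

Lemma cochain_gauge_action :
  is_right_action (cochain_C1 D_bc) *%R 1 (cochain_Z2 D_bc)
    (cochain_gauge D_bc).
Proof.
split.
- exact: gauge_in.
- by move=> c _; rewrite /cochain_gauge rinv1 !rmorph1 !mul1r mulr1.
- move=> c r q _ Cr Cq; have [ur _ _ vr] := Cr; have [uq _ _ _] := Cq.
  have [_ _ _ vV] := cochain_C1_inv Cr.
  rewrite /cochain_gauge rinvM // !rmorphM /= !mulrA.
  rewrite -[const _ _ * const _ _ * push _ _]mulrA -(push_action_const _ vV).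
  by rewrite !mulrA.
Qed.

(** The coboundary of [r] is the gauge transform of the trivial cocycle. *)
Definition cochain_Z1 : set A1 :=
  [set r | cochain_C1 D_bc r /\ cochain_gauge D_bc 1 r = 1].

Lemma cochain_Z1P r : cochain_C1 D_bc r ->
  cochain_gauge D_bc 1 r = 1 <-> opmul r = push alpha r * const S r.
Proof.
move=> [ur _ _ vr]; set a := const S r; set p := push alpha r.
have aV : a * const S (rinv r) = 1 := mulr_morph_inv (const S) ur.
have Va : const S (rinv r) * a = 1 := mul_morph_invr (const S) ur.
have pV : p * push alpha (rinv r) = 1 := mulr_morph_inv (push alpha) ur.
have Vp : push alpha (rinv r) * p = 1 := mul_morph_invr (push alpha) ur.
rewrite /cochain_gauge mulr1 -mulrA -/p -/a; split=> [d1|->].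
  by rewrite -[RHS]mulr1 -d1 -mulrA (mul_cancel _ aV) (mul_cancel _ pV).
by rewrite (mul_cancel _ Vp) Va.
Qed.

(** [cochain_Z1] is the stabiliser of the trivial cocycle. *)
Lemma cochain_Z1_group : is_group cochain_Z1 *%R 1.
Proof.
have gA := cochain_gauge_action.
split.
- move=> r q [Cr r1] [Cq q1]; split.
    exact: (is_groupM (cochain_C1_group D_bc)).
  by rewrite (is_actM gA (cochain_Z2_1 D_bc)) // r1.
- split; first exact: (is_group1 (cochain_C1_group D_bc)).
  exact: (is_act1 gA (cochain_Z2_1 D_bc)).
- by move=> x y z _ _ _; rewrite mulrA.
- by move=> x _; rewrite mul1r.
- by move=> x _; rewrite mulr1.
- move=> r [Cr r1]; have [ur _ _ _] := Cr; have CV := cochain_C1_inv Cr.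
  exists (rinv r); last by rewrite mulrinv // mulinvr.
  split=> //; rewrite -{1}r1 -(is_actM gA (cochain_Z2_1 D_bc)) // mulrinv //.
  exact: (is_act1 gA (cochain_Z2_1 D_bc)).
Qed.

End Gauge.

(** * Extension of cochains to the smash product *)

Section Extension.
Variables (k : fieldType) (H : algType k) (S : hopf_algebra H).
Variables (B : algType k) (D : dy_module S B) (D_bc : braided_commutative D).
Local Notation L := (B \ox H)%type.
Local Notation "b <| h" := (act D b h) (at level 35).
Local Notation "X ** Y" := (smash_mul D X Y) (at level 40, left associativity).
Local Notation s := (@smash_src _ H B).
Local Notation t := (smash_tgt D).
Local Notation alpha := (action D_bc).

(** The [phi]-linear extension of [f] from [H = 1 # H] to the smash product. *)
Definition ext (A : algType k) (phi : B -> A) (f : cochain S A) (X : L) : A :=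
  \tsum_(a, h <- X) (phi a * f h).

Section Linear.
Variables (A : algType k) (phi : {linear B -> A}).
Implicit Types (f g : cochain S A) (X Y : L).

Lemma ext_kbalanced f : kbalanced (fun a h => phi a * f h).
Proof.
apply: bilinear_kbalanced => [y|x] c u v /=.
  by rewrite linearP mulrDl scalerAl.
by rewrite linearP mulrDr scalerAr.
Qed.

Lemma ext_pure f a h : ext phi f (a \ox h) = phi a * f h.
Proof. exact: (tensor_lift_pure (ext_kbalanced f)). Qed.

Lemma extD f : {morph ext phi f : X Y / X + Y}.
Proof. by move=> X Y; apply: (tensor_liftD (ext_kbalanced f)). Qed.

Lemma ext_linear f : linear (ext phi f).
Proof.
move=> c X Y; rewrite extD /ext kbalanced_Z // => [h|a] d u v.
  by rewrite linearP mulrDl scalerAl.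
by rewrite linearP mulrDr scalerAr.
Qed.

Lemma ext_tsum f (V W : zmodType) (T : Type) (ra : V -> T -> V)
    (la : T -> W -> W) (u : tensor ra la) (F : V -> W -> L) :
  ext phi f (\tsum_(v, w <- u) F v w) = \tsum_(v, w <- u) ext phi f (F v w).
Proof. exact: (tsum_tsum _ _ (ext_kbalanced f)). Qed.

Lemma ext_tsuml (V W : zmodType) (T : Type) (ra : V -> T -> V)
    (la : T -> W -> W) (u : tensor ra la) (F : V -> W -> cochain S A) X :
  ext phi (\tsum_(v, w <- u) F v w) X = \tsum_(v, w <- u) ext phi (F v w) X.
Proof.
rewrite /ext [RHS]tsum_exchange; apply: eq_tensor_lift => a h.
by rewrite tsum_cochain mulr_tsumr.
Qed.

Lemma ext_inj f g : phi 1 = 1 -> (forall X, ext phi f X = ext phi g X) -> f = g.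
Proof.
move=> phi1 fg; apply: cochainP => h; have := fg (1 \ox h).
by rewrite !ext_pure phi1 !mul1r.
Qed.

Lemma mul_ext a f X : (forall b, a * phi b = phi b * a) ->
  a * ext phi f X = ext phi (const S a * f) X.
Proof.
move=> aC; rewrite /ext mulr_tsumr; apply: eq_tensor_lift => b h.
by rewrite constMl !mulrA aC.
Qed.

Lemma push_ext (A' : algType k) (psi : {lrmorphism A -> A'}) f X :
  psi (ext phi f X) = ext (psi \o phi) (push psi f) X.
Proof.
rewrite linear_tsum; apply: eq_tensor_lift => b h.
by rewrite rmorphM.
Qed.

End Linear.

Section Multiplicative.
Variables (A : algType k) (phi : {lrmorphism B -> A}).
Implicit Types (f g : cochain S A) (X Y : L).
Local Notation phi' := (push phi \o alpha).

(** Evaluating an extension at a product is evaluating twice: the inner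
    extension, at the right factor, has values in the convolution algebra. *)
Lemma ext_mul f X Y :
  ext phi f (X ** Y) = ext phi (ext phi' (opmul f) Y) X.
Proof.
rewrite /smash_mul ext_tsum; apply: eq_tensor_lift => a h.
rewrite ext_tsum [in RHS]/ext tsum_cochain mulr_tsumr.
apply: eq_tensor_lift => b g.
rewrite cochainM mulr_sw2r /sw2 ext_tsum; apply: eq_tensor_lift => h1 h2.
by rewrite ext_pure rmorphM mulrA.
Qed.

Lemma ext_src f b X : ext phi f (s b ** X) = phi b * ext phi f X.
Proof.
rewrite ext_mul ext_pure; congr (_ * _).
rewrite /ext tsum_cochain; apply: eq_tensor_lift => a h.
rewrite cochainM (sw2_1 S (mul_kbalanced _ _)) /=.
by rewrite act1 mulr1.
Qed.

Lemma ext_mul_src f b X :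
  ext phi f (X ** s b) = ext phi (push phi (alpha b) * f) X.
Proof.
rewrite ext_mul ext_pure; congr (ext phi (_ * _) X).
by apply: cochainP => h; rewrite /= mul1r.
Qed.

Lemma ext_mul_tgt f b X : twisted D phi f ->
  ext phi f (X ** t b) = ext phi (f * push phi (alpha b)) X.
Proof. by move=> ftw; rewrite ext_mul (mul_push_action D_bc b ftw). Qed.

Lemma twisted_ext_opmul f X :
  twisted D phi f -> twisted D phi (ext phi' (opmul f) X).
Proof.
move=> ftw; apply: twisted_sum => a h; apply: twisted_mul.
  exact: (twisted_push (phi := idfun) phi (twisted_action D_bc a)).
exact: twisted_opmul.
Qed.

(** By [ext_mul] both sides come from the extension of one cochain, twisted
    like [f]: its value at [t b] on the left, at [s 1] on the right. So the
    claim is the twisted condition at [h = 1]. *)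
Lemma ext_tgt f b X : twisted D phi f ->
  ext phi f (t b ** X) = ext phi f X * phi b.
Proof.
move=> ftw; have Gtw := twisted_ext_opmul X ftw.
have -> : ext phi f X = ext phi f (s 1 ** X) by rewrite ext_src rmorph1 mul1r.
rewrite !ext_mul ext_pure rmorph1 mul1r -Gtw /ext.
by apply: eq_tensor_lift => b0 b1; rewrite mul1r.
Qed.

Lemma ext_bimod f b c X : twisted D phi f ->
  ext phi f (s b ** t c ** X) = phi b * ext phi f X * phi c.
Proof.
move=> ftw; have Gtw := twisted_ext_opmul X ftw.
by rewrite ext_mul ext_src -ext_mul ext_tgt // mulrA.
Qed.

(** The twisted condition on [f] makes the summand balanced over [B], so that
    the sum may be computed on the representatives [a # h1], [1 # h2]. *)
Lemma ext_comul f g X : twisted D phi f ->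
  \tsum_(X1, X2 <- smash_comul D X) (ext phi f X1 * ext phi g X2) =
  ext phi (f * g) X.
Proof.
move=> ftw.
have bal : balanced (fun X b => t b ** X) (fun b Y => s b ** Y)
    (fun X1 X2 => ext phi f X1 * ext phi g X2).
  split=> [X1 X1' X2|X1 X2 X2'|X1 b X2].
  - by rewrite extD mulrDl.
  - by rewrite extD mulrDr.
  - by rewrite ext_tgt // ext_src mulrA.
rewrite /smash_comul (tsum_tsum _ _ bal); apply: eq_tensor_lift => a h.
rewrite /sw2 (tsum_tsum _ _ bal) cochainM mulr_sw2r.
apply: eq_tensor_lift => h1 h2.
by rewrite (tensor_lift_pure bal) !ext_pure rmorph1 mul1r mulrA.
Qed.

Lemma src_mulE a Y : s a ** Y = \tsum_(b, g <- Y) (a * b) \ox g.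
Proof.
pose F (b : B) (g : H) a' h :=
  sw2 S h (fun h1 h2 => (a' * (b <| h1)) \ox (g * h2)).
have Fl b (g : H) h : linear (F b g ^~ h).
  move=> c u v; rewrite /F scaler_sw2 -sw2_add; apply: eq_sw2 => h1 h2.
  by rewrite mulrDl kpureDl -scalerAl scaler_kpure.
have bal b (g : H) (a' : B) :
    kbalanced (fun h1 h2 => (a' * (b <| h1)) \ox (g * h2)).
  apply: bilinear_kbalanced => [y|x] c u v /=.
    by rewrite act_linearr mulrDr kpureDl -scalerAr scaler_kpure.
  by rewrite mulrDr kpureDr -scalerAr -kpure_bal scaler_kpure.
have Fr b (g : H) a' : linear (F b g a').
  apply: sw2_linear => [y|x] c u v /=.
    by rewrite act_linearr mulrDr kpureDl -scalerAr scaler_kpure.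
  by rewrite mulrDr kpureDr -scalerAr -kpure_bal scaler_kpure.
transitivity (\tsum_(b, g <- Y) F b g a 1).
  rewrite /smash_mul; apply: (tensor_lift_pure (V := B) (W := H)
    (F := fun a h => \tsum_(b, g <- Y) F b g a h)).
  by apply: bilinear_kbalanced => [y|x] c u v;
    rewrite scaler_tsum -tensor_lift_add; apply: eq_tensor_lift => b g;
    rewrite (Fl, Fr).
by apply: eq_tensor_lift => b g; rewrite /F (sw2_1 S (bal _ _ _)) act1 mulr1.
Qed.

Lemma src_pure a b h : s a ** (b \ox h) = (a * b) \ox h.
Proof.
rewrite src_mulE.
apply: (tensor_lift_pure (F := fun b (g : H) => (a * b) \ox g)).
apply: bilinear_kbalanced => [y|x] c u v.
  by rewrite mulrDr kpureDl -scalerAr scaler_kpure.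
by rewrite kpureDr -kpure_bal scaler_kpure.
Qed.

Lemma src1_mul Y : s 1 ** Y = Y.
Proof.
rewrite src_mulE -[RHS]tsum_pure; apply: eq_tensor_lift => b g.
by rewrite mul1r.
Qed.

Lemma tgt1 : t 1 = s 1.
Proof. exact: coact_unit D_bc. Qed.

Lemma bimod_split (W : L -> A) :
  (forall b c X, W (s b ** t c ** X) = phi b * W X * phi c) ->
  (forall b X, W (s b ** X) = phi b * W X) /\
  (forall b X, W (t b ** X) = W X * phi b).
Proof.
move=> Wbimod; split=> b X.
  have := Wbimod b 1 X; rewrite rmorph1 mulr1 tgt1 => <-.
  by rewrite [s b ** s 1]src_pure mulr1.
by have := Wbimod 1 b X; rewrite rmorph1 mul1r src1_mul.
Qed.

Lemma tgt_pure b h :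
  t b ** (1 \ox h) = \tsum_(b0, b1 <- coact D b) b0 \ox (h * b1).
Proof.
rewrite /smash_mul; apply: eq_tensor_lift => b0 b1.
rewrite tensor_lift_pure; last first.
  split=> [a a' g|a g g'|a c g].
  - rewrite -sw2_add; apply: eq_sw2 => h1 h2.
    by rewrite -[act D _ _]/(alpha (a + a') h1) linearD mulrDr kpureDl.
  - by rewrite -sw2_add; apply: eq_sw2 => h1 h2; rewrite mulrDl kpureDr.
  - apply: eq_sw2 => h1 h2.
    rewrite -[act D _ _]/(alpha (c *: a) h1) linearZ.
    by rewrite -scalerAr -scalerAl kpure_bal.
under eq_sw2 => h1 h2 do rewrite (act_unit D_bc) mulr_algr -scaler_kpure.
rewrite (sw2_counitl S b1 (f := fun x => b0 \ox (h * x))) // => c x y.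
by rewrite mulrDr kpureDr -scalerAr -kpure_bal scaler_kpure.
Qed.

(** Linearity over the source makes [W] the extension of its restriction to
    [1 ⊗ H]; linearity over the target is then the twisted condition. *)
Lemma extP (W : L -> A) : {morph W : X Y / X + Y} ->
  (forall b X, W (s b ** X) = phi b * W X) ->
  (forall b X, W (t b ** X) = W X * phi b) ->
  exists2 f : cochain S A, twisted D phi f & W = ext phi f.
Proof.
move=> WD Ws Wt.
have Wa a h : W (a \ox h) = phi a * W (1 \ox h) by rewrite -Ws src_pure mulr1.
have f_lin : linear (fun h => W (1 \ox h)).
  move=> c h h'; rewrite kpureDr WD -kpure_bal Wa.
  by rewrite linearZ /= rmorph1 mulr_algl.
exists (Cochain S f_lin) => [h b|].
  rewrite /= -Wt tgt_pure (additive_tsum _ _ WD).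
  by apply: eq_tensor_lift => b0 b1; rewrite [RHS]Wa.
apply: funext => X; rewrite (tensor_additiveE _ WD).
by apply: eq_tensor_lift => a h; apply: Wa.
Qed.

End Multiplicative.

Lemma ext_counit X : ext idfun (1 : cochain S B) X = smash_counit S X.
Proof. by apply: eq_tensor_lift => a h; rewrite cochain1 mulr_algr. Qed.

Lemma push_idfun (f : cochain S B) : push idfun f = f.
Proof. exact: cochainP. Qed.

Lemma ext_mul_id (f : cochain S B) X Y :
  ext idfun f (X ** Y) = ext idfun (ext alpha (opmul f) Y) X.
Proof.
rewrite ext_mul; congr (ext idfun _ X); apply: eq_tensor_lift => b g.
by rewrite /= push_idfun.
Qed.

Lemma ext1_pure f h : ext idfun f (1 \ox h) = f h.
Proof. by rewrite ext_pure mul1r. Qed.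

End Extension.

(** * Transport of structure *)

Section TransportInverse.
Variables (A : nzRingType) (P : set A) (T : choiceType) (M : set T).
Variables (op : T -> T -> T) (e : T) (E : A -> T).
Hypothesis M_E : forall y, M y <-> exists2 x, P x & y = E x.
Hypothesis E_inj : forall x y, P x -> P y -> E x = E y -> x = y.
Hypothesis E_M : forall x y, P x -> P y -> op (E x) (E y) = E (x * y).
Hypothesis E_1 : e = E 1.
Hypothesis P_M : forall x y, P x -> P y -> P (x * y).
Hypothesis P_1 : P 1.
Hypothesis P_V : forall x, has_inv x -> P x -> P (rinv x).

Lemma transport_is_inverse x y : P x -> P y ->
  is_inverse M op e (E x) (E y) <-> x * y = 1 /\ y * x = 1.
Proof.
move=> Px Py; split=> [[_]|[xy yx]].
  by rewrite E_1 !E_M // => /E_inj xy /E_inj yx; split;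
    [apply: xy|apply: yx] => //; apply: P_M.
by split; rewrite ?E_M // ?E_1 ?xy ?yx //; apply/M_E; exists y.
Qed.

Lemma transport_invertible x : P x -> invertible M op e (E x) <-> has_inv x.
Proof.
move=> Px; split=> [[y yi]|ux].
  have [/M_E[z Pz yz] _ _] := yi; rewrite yz in yi.
  by have [xz zx] := (transport_is_inverse Px Pz).1 yi; apply: has_invP xz zx.
exists (E (rinv x)); apply/transport_is_inverse => //; first exact: P_V.
by rewrite mulrinv // mulinvr.
Qed.

(** An inverse in [M] is unique, so the chosen one is the image of the ring
    inverse. *)
Lemma transport_inverse x :
  P x -> has_inv x -> inverse M op e (E x) = E (rinv x).
Proof.
move=> Px ux; have /(transport_invertible Px) := ux.
move=> /(xgetPex e) xi; rewrite /inverse.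
have [/M_E[z Pz yz] _ _] := xi; rewrite yz in xi *.
have [xz zx] := (transport_is_inverse Px Pz).1 xi.
by rewrite (rinvE xz zx).
Qed.

End TransportInverse.

Section TransportGroup.
Variables (T T' : Type) (G : set T) (op : T -> T -> T) (e : T).
Variables (op' : T' -> T' -> T') (E : T -> T').
Hypothesis E_M : forall x y, G x -> G y -> op' (E x) (E y) = E (op x y).

Lemma transport_group : is_group G op e -> is_group (E @` G) op' (E e).
Proof.
case=> GM G1 GA G1m Gm1 GV; split.
- move=> _ _ [x Gx <-] [y Gy <-]; rewrite E_M //.
  by exists (op x y) => //; apply: GM.
- by exists e.
- move=> _ _ _ [x Gx <-] [y Gy <-] [z Gz <-].
  by rewrite !E_M //; [rewrite GA|apply: GM..].
- by move=> _ [x Gx <-]; rewrite E_M // G1m.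
- by move=> _ [x Gx <-]; rewrite E_M // Gm1.
- move=> _ [x Gx <-]; have [y Gy [xy yx]] := GV _ Gx.
  by exists (E y); [exists y|rewrite !E_M // xy yx].
Qed.

Lemma opposite_group : is_group G op e -> is_group G (opposite op) e.
Proof.
case=> GM G1 GA G1m Gm1 GV; split=> //; rewrite /opposite.
- by move=> x y Gx Gy; apply: GM.
- by move=> x y z Gx Gy Gz; rewrite GA.
- by move=> x Gx; have [y Gy [xy yx]] := GV _ Gx; exists y.
Qed.

Variables (X X' : Type) (Z : set X) (a : X -> T -> X) (a' : X' -> T' -> X').
Variable F : X -> X'.
Hypothesis F_a : forall x g, Z x -> G g -> a' (F x) (E g) = F (a x g).

Hypothesis G_group : is_group G op e.

Lemma transport_action : is_right_action G op e Z a ->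
  is_right_action (E @` G) op' (E e) (F @` Z) a'.
Proof.
case=> aZ a1 aM; split.
- move=> _ _ [x Zx <-] [g Gg <-]; rewrite F_a //.
  by exists (a x g) => //; apply: aZ.
- by move=> _ [x Zx <-]; rewrite F_a ?a1 //; apply: (is_group1 G_group).
- move=> _ _ _ [x Zx <-] [g Gg <-] [h Gh <-]; rewrite E_M // !F_a //.
  + by rewrite aM.
  + exact: aZ.
  + exact: (is_groupM G_group).
Qed.

Hypothesis F_inj : forall x y, Z x -> Z y -> F x = F y -> x = y.
Hypothesis Z_a : forall x g, Z x -> G g -> Z (a x g).

Lemma transport_orbits :
  set_bij (orbits G Z a) (orbits (E @` G) (F @` Z) a') (image^~ F).
Proof.
have orb x : Z x -> F @` [set a x g | g in G] =
    [set a' (F x) g | g in E @` G].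
  move=> Zx; apply/seteqP; split=> y.
    by move=> [_ [g Gg <-] <-]; exists (E g); [exists g|rewrite F_a].
  by move=> [_ [g Gg <-] <-]; rewrite F_a //; exists (a x g) => //; exists g.
have orbZ O : orbits G Z a O -> O `<=` Z.
  by move=> [x Zx <-] _ [g Gg <-]; apply: Z_a.
split.
- by move=> _ [x Zx <-]; rewrite /= orb //; exists (F x) => //; exists x.
- move=> O O'; rewrite !inE => /orbZ OZ /orbZ OZ' /seteqP[OO' O'O].
  apply/seteqP; split=> x Ox.
    have [y Oy /F_inj yx] := OO' (F x) (ex_intro2 _ _ x Ox erefl).
    by rewrite -yx //; [apply: OZ'|apply: OZ].
  have [y Oy /F_inj yx] := O'O (F x) (ex_intro2 _ _ x Ox erefl).
  by rewrite -yx //; [apply: OZ|apply: OZ'].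
- move=> _ [_ [x Zx <-] <-]; exists [set a x g | g in G]; last exact: orb.
  by exists x.
Qed.

End TransportGroup.

(** The common source will be the set of orbits of cochains, which is compared
    separately with the orbits on [H] and with those on the Hopf algebroid. *)
Lemma set_bij_common_source (T1 T2 T3 : Type) (A1 : set (set T1))
    (A2 : set (set T2)) (A3 : set (set T3)) p q :
  set_bij A1 A2 p -> set_bij A1 A3 q -> exists f, set_bij A2 A3 f.
Proof.
move=> [pF pI pS] [qF qI qS].
pose r y := xget set0 [set x | A1 x /\ p x = y].
have rP y : A2 y -> A1 (r y) /\ p (r y) = y.
  move=> /pS[x Ax pxy].
  exact: (@xgetPex _ _ [set x | A1 x /\ p x = y] (ex_intro _ x (conj Ax pxy))).
exists (q \o r); split.
- by move=> y /rP[Ar _]; apply: qF.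
- move=> y z; rewrite !inE => /rP[Ary py] /rP[Arz pz] /= /qI rr.
  by rewrite -py -pz rr // inE.
- move=> z /qS[x Ax <-]; exists (p x); first exact: pF.
  have [Ar pr] := rP _ (pF _ Ax).
  by congr q; apply: pI; rewrite ?inE.
Qed.

(** * Cochains as functions on [H] and on [H ⊗ H] *)

Section Uncurry.
Variables (k : fieldType) (H : algType k) (S : hopf_algebra H).
Variables (B : algType k) (D : dy_module S B) (D_bc : braided_commutative D).
Local Notation alpha := (action D_bc).
Local Notation A1 := (cochain S B).
Local Notation A2 := (cochain S A1).
Implicit Types (r q : A1) (c d : A2) (b : B) (g h : H).

Lemma linear_mapsP (f : H -> B) :
  linear_maps f <-> exists2 r : A1, [set: A1] r & f = r.
Proof.
split=> [flin|[r _ ->]]; last exact: cfunP.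
by exists (Cochain S flin).
Qed.

Lemma cfun_inj r q : (r : H -> B) = q -> r = q.
Proof. by move=> rq; apply: cochainP => h; rewrite rq. Qed.

Lemma invertible_conv r :
  invertible (@linear_maps _ _ B) (conv S) (conv1 S B) r <-> has_inv r.
Proof.
by apply: (transport_invertible linear_mapsP) => // x y _ _; apply: cfun_inj.
Qed.

Lemma convVE r : has_inv r -> convV S r = rinv r.
Proof.
by apply: (transport_inverse linear_mapsP) => // x y _ _; apply: cfun_inj.
Qed.

Lemma C1_verP r : C1_ver D r <-> cochain_C1 D_bc r.
Proof.
split=> [[_ /invertible_conv ur r1 rtw vr]|[ur r1 rtw vr]]; split=> //.
- by move=> b; apply: cochainP => h; apply: vr.
- exact: cfunP.
- exact/invertible_conv.
- by move=> h b; have := congr1 (fun f : A1 => f h) (vr b).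
Qed.

Lemma C1_verE : C1_ver D = @cfun _ _ S B @` cochain_C1 D_bc.
Proof.
apply/seteqP; split=> [f|_ [r /C1_verP Cr <-] //].
move=> Cf; have [flin _ _ _ _] := Cf.
by exists (Cochain S flin) => //; apply/C1_verP.
Qed.

Definition uncurry c : (H \ox H)%type -> B := fun x => \tsum_(h, g <- x) c g h.

Lemma uncurry_pure c h g : uncurry c (h \ox g) = c g h.
Proof.
apply: (tensor_lift_pure (F := fun h g => c g h)).
by apply: bilinear_kbalanced => [y|x] a u v; rewrite linearP.
Qed.

Lemma uncurry_inj : injective uncurry.
Proof.
move=> c d cd; apply: cochainP => g; apply: cochainP => h.
by rewrite -!uncurry_pure cd.
Qed.

Lemma uncurry_linear c : linear (uncurry c).
Proof.
have cl w : linear (fun h => c w h) by exact: cfunP.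
have cr v : linear (fun g => c g v) by move=> a x y; rewrite linearP.
move=> a x y; rewrite /uncurry (tensor_liftD (bilinear_kbalanced cl cr)).
by rewrite (kbalanced_Z cl cr).
Qed.

Lemma linear_maps2P (f : (H \ox H)%type -> B) :
  linear_maps2 f <-> exists2 c : A2, [set: A2] c & f = uncurry c.
Proof.
split=> [flin|[c _ ->]]; last exact: uncurry_linear.
have fl g : linear (fun h => f (h \ox g)).
  by move=> a x y; rewrite kpureDl -scaler_kpure flin.
have fr : linear (fun g => Cochain S (fl g)).
  move=> a x y; apply: cochainP => h /=.
  by rewrite kpureDr -kpure_bal -scaler_kpure flin.
exists (Cochain S fr) => //; apply: funext => x.
rewrite (tensor_additiveE _ (linear_morphD flin)).
by apply: eq_tensor_lift => h g.
Qed.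

Lemma conv2E c d : conv2 S (uncurry c) (uncurry d) = uncurry (c * d).
Proof.
apply: funext => x; apply: eq_tensor_lift => h g.
rewrite cochainM sw2_cochain; under [RHS]eq_sw2 => g1 g2 do rewrite cochainM.
rewrite [RHS]tsum_exchange; apply: eq_sw2 => h1 h2; apply: eq_sw2 => g1 g2.
by rewrite !uncurry_pure.
Qed.

Lemma conv2_1E : conv2_1 S B = uncurry 1.
Proof.
apply: funext => x; apply: eq_tensor_lift => h g.
by rewrite cochain1 cochainZ cochain1 scalerA mulrC.
Qed.

Lemma invertible_conv2 c :
  invertible (@linear_maps2 _ _ B) (@conv2 _ _ S B) (conv2_1 S B)
    (uncurry c) <-> has_inv c.
Proof.
apply: (transport_invertible linear_maps2P) => //.
- by move=> x y _ _; apply: uncurry_inj.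
- by move=> x y _ _; apply: conv2E.
- exact: conv2_1E.
Qed.

Lemma Z2P c : Z2 D (uncurry c) <-> cochain_Z2 D_bc c.
Proof.
have e0E f g h : (push (push alpha) c * opmul c) f g h =
    sw2 S f (fun f1 f2 => sw2 S g (fun g1 g2 => sw2 S h (fun h1 h2 =>
    act D (uncurry c (g1 \ox f1)) h1 * uncurry c (h2 \ox (f2 * g2))))).
  rewrite cochainM !sw2_cochain; apply: eq_sw2 => f1 f2.
  rewrite cochainM !sw2_cochain; apply: eq_sw2 => g1 g2.
  by apply: eq_sw2 => h1 h2; rewrite !uncurry_pure.
have e1E f g h : (const S c * push opmul c) f g h =
    sw2 S g (fun g1 g2 => sw2 S h (fun h1 h2 =>
    uncurry c (h1 \ox g1) * uncurry c ((g2 * h2) \ox f))).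
  rewrite constMl cochainM !sw2_cochain; apply: eq_sw2 => g1 g2.
  by apply: eq_sw2 => h1 h2; rewrite !uncurry_pure.
have lE g h b : (c * opmul (alpha b)) g h =
    sw2 S g (fun g1 g2 => sw2 S h (fun h1 h2 =>
    uncurry c (h1 \ox g1) * act D b (g2 * h2))).
  rewrite cochainM !sw2_cochain; apply: eq_sw2 => g1 g2.
  by apply: eq_sw2 => h1 h2; rewrite !uncurry_pure.
have rE g h b : (opmul (alpha b) * c) g h =
    sw2 S g (fun g1 g2 => sw2 S h (fun h1 h2 =>
    act D b (g1 * h1) * uncurry c (h2 \ox g2))).
  rewrite cochainM !sw2_cochain; apply: eq_sw2 => g1 g2.
  by apply: eq_sw2 => h1 h2; rewrite !uncurry_pure.
have aE g h b : (c g * alpha b) h =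
    sw2 S h (fun h1 h2 => uncurry c (h1 \ox g) * act D b h2).
  by apply: eq_sw2 => h1 h2; rewrite uncurry_pure.
have bE g h b : (\tsum_(b0, b1 <- coact D b) (alpha b0 * c (g * b1))) h =
    \tsum_(b0, b1 <- coact D b)
      sw2 S h (fun h1 h2 => act D b0 h1 * uncurry c (h2 \ox (g * b1))).
  rewrite tsum_cochain; apply: eq_tensor_lift => b0 b1.
  by apply: eq_sw2 => h1 h2; rewrite uncurry_pure.
split.
  move=> [_ /invertible_conv2 uc c1 [cc cC c3 c4]]; split=> //.
  - split.
      by apply: cochainP => h; have [+ _] := c1 h; rewrite uncurry_pure.
    by apply: cochainP => h; have [_ +] := c1 h; rewrite uncurry_pure.
  - apply: cochainP => f; apply: cochainP => g; apply: cochainP => h.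
    by rewrite e0E e1E.
  - move=> b; apply: cochainP => g; apply: cochainP => h.
    by rewrite lE rE.
  - split.
      by move=> g b; apply: cochainP => h; rewrite bE aE.
    move=> g h b; rewrite -uncurry_pure -c4.
    by apply: eq_tensor_lift => b0 b1; rewrite uncurry_pure.
move=> [uc [c1 c1'] cc cC [c3 c4]]; split.
- exact: uncurry_linear.
- exact/invertible_conv2.
- move=> h; rewrite !uncurry_pure; split.
    by have := congr1 (fun f : A1 => f h) c1.
  by have := congr1 (fun f : A1 => f h) c1'.
- split.
  + by move=> f g h; rewrite -e0E -e1E cc.
  + by move=> g h b; rewrite -lE -rE cC.
  + by move=> g h b; rewrite -aE -bE c3.
  + move=> g h b; rewrite uncurry_pure -[RHS]c4.
    by apply: eq_tensor_lift => b0 b1; rewrite uncurry_pure.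
Qed.

Lemma Z2E : Z2 D = uncurry @` cochain_Z2 D_bc.
Proof.
apply/seteqP; split=> [f|_ [c /Z2P Zc <-] //].
move=> Zf; have [/linear_maps2P[c _ fc] _ _ _] := Zf.
by rewrite fc in Zf *; exists c => //; apply/Z2P.
Qed.

(** The convolution algebra sums over the components of [g] and [h]
    alternately, and the Sweedler notation over those of [h] first; hence
    the exchanges of sums. *)
Lemma cochain_gaugeE c r g h : cochain_gauge D_bc c r g h =
  sw4 S h (fun h1 h2 h3 h4 => sw3 S g (fun g1 g2 g3 =>
    rinv r h1 * act D (rinv r g1) h2 * c g2 h3 * r (g3 * h4))).
Proof.
rewrite /cochain_gauge -!mulrA constMl cochainM; apply: eq_sw2 => h1 t.
rewrite cochainM sw2_cochain mulr_sw2r.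
transitivity (sw2 S g (fun g1 v => sw2 S t (fun h2 u =>
    sw2 S v (fun g2 g3 => sw2 S u (fun h3 h4 =>
    rinv r h1 * act D (rinv r g1) h2 * c g2 h3 * r (g3 * h4)))))).
  apply: eq_sw2 => g1 v; rewrite cochainM mulr_sw2r; apply: eq_sw2 => h2 u.
  rewrite cochainM sw2_cochain !mulr_sw2r; apply: eq_sw2 => g2 g3.
  rewrite cochainM !mulr_sw2r; apply: eq_sw2 => h3 h4.
  by rewrite /= !mulrA.
rewrite [LHS]tsum_exchange; apply: eq_sw2 => h2 u.
transitivity (sw2 S g (fun g1 v => sw2 S u (fun h3 h4 =>
    sw2 S v (fun g2 g3 =>
    rinv r h1 * act D (rinv r g1) h2 * c g2 h3 * r (g3 * h4))))).
  by apply: eq_sw2 => g1 v; apply: tsum_exchange.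
exact: tsum_exchange.
Qed.

Lemma cochain_gauge1E r g h : cochain_gauge D_bc 1 r g h =
  sw3 S h (fun h1 h2 h3 => sw2 S g (fun g1 g2 =>
    rinv r h1 * act D (rinv r g1) h2 * r (g2 * h3))).
Proof.
rewrite /cochain_gauge mulr1 -!mulrA constMl cochainM; apply: eq_sw2 => h1 t.
rewrite cochainM sw2_cochain mulr_sw2r [RHS]tsum_exchange.
apply: eq_sw2 => g1 g2.
rewrite cochainM mulr_sw2r; apply: eq_sw2 => h2 h3.
by rewrite /= !mulrA.
Qed.

Lemma gaugeE c r : cochain_C1 D_bc r ->
  gauge D (uncurry c) r = uncurry (cochain_gauge D_bc c r).
Proof.
move=> [ur _ _ _]; apply: funext => x; apply: eq_tensor_lift => h g.
rewrite cochain_gaugeE (convVE ur).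
apply: eq_sw2 => h1 t; apply: eq_sw2 => h2 u; apply: eq_sw2 => h3 h4.
apply: eq_sw2 => g1 v; apply: eq_sw2 => g2 g3.
by rewrite uncurry_pure.
Qed.

Lemma coboundaryE r : cochain_C1 D_bc r ->
  coboundary D r = uncurry (cochain_gauge D_bc 1 r).
Proof.
move=> [ur _ _ _]; apply: funext => x; apply: eq_tensor_lift => h g.
by rewrite cochain_gauge1E (convVE ur).
Qed.

Lemma Z1_verE : Z1_ver D = @cfun _ _ S B @` cochain_Z1 D_bc.
Proof.
have Z1P r : cochain_C1 D_bc r ->
    (forall h g, coboundary D r (h \ox g) = (counit S h * counit S g)%:A) <->
    cochain_gauge D_bc 1 r = 1.
  move=> Cr; rewrite coboundaryE //; split=> [d1|-> h g].
    apply: uncurry_inj; rewrite -conv2_1E; apply: funext => x.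
    rewrite (tensor_additiveE _ (linear_morphD (uncurry_linear _))).
    by apply: eq_tensor_lift => h g; apply: d1.
  by rewrite uncurry_pure cochain1 cochainZ cochain1 scalerA mulrC.
apply/seteqP; split=> [f|_ [r [Cr r1] <-]]; last first.
  by split; [apply/C1_verP|apply/Z1P].
move=> [+ d1]; rewrite C1_verE => -[r Cr fr]; rewrite -fr in d1 *.
by exists r => //; split=> //; apply/Z1P.
Qed.

End Uncurry.

(** * Cochains of the action Hopf algebroid *)

Section Algebroid.
Variables (k : fieldType) (H : algType k) (S : hopf_algebra H).
Variables (B : algType k) (D : dy_module S B) (D_bc : braided_commutative D).
Local Notation L := (B \ox H)%type.
Local Notation LD := (smash D).
Local Notation "X ** Y" := (smash_mul D X Y) (at level 40, left associativity).
Local Notation s := (@smash_src _ H B).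
Local Notation t := (smash_tgt D).
Local Notation alpha := (action D_bc).
Local Notation A1 := (cochain S B).
Local Notation A2 := (cochain S A1).
Local Notation psi := (push alpha \o alpha).
Implicit Types (r q : A1) (c d : A2) (b : B) (g h : H) (X Y Z : L).

Definition ext1 r : LD -> B := ext idfun r.

Lemma ext1_inj : injective ext1.
Proof.
move=> r q rq; apply: (ext_inj (phi := idfun)) => // X.
by rewrite -/(ext1 r X) rq.
Qed.

Lemma bimod_mapsP (W : LD -> B) :
  bimod_maps W <-> exists2 r : A1, [set r | twisted D idfun r] r & W = ext1 r.
Proof.
split=> [[Wlin Wbimod]|[r rtw ->]]; last first.
  split; first exact: (ext_linear idfun).
  by move=> b c X; rewrite /ext1 /= (ext_bimod D_bc (phi := idfun)).
have [Ws Wt] := bimod_split D_bc (phi := idfun) Wbimod.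
exact: (extP D_bc (phi := idfun) (linear_morphD Wlin) Ws Wt).
Qed.

Lemma ext1_comul r q X : twisted D idfun r ->
  \tsum_(X1, X2 <- smash_comul D X) (ext1 r X1 * ext1 q X2) = ext1 (r * q) X.
Proof. exact: (ext_comul D_bc (phi := idfun)). Qed.

Lemma bconvE r q : twisted D idfun r ->
  bconv (ext1 r) (ext1 q) = ext1 (r * q).
Proof. by move=> rtw; apply: funext => X; apply: ext1_comul. Qed.

Lemma bcounitE : @bcounit _ _ LD = ext1 1.
Proof. by apply: funext => X; rewrite /ext1 ext_counit. Qed.

Lemma invertible_bconv r : twisted D idfun r ->
  invertible (@bimod_maps _ _ LD) (@bconv _ _ LD) (@bcounit _ _ LD) (ext1 r) <->
  has_inv r.
Proof.
apply: (transport_invertible bimod_mapsP).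
- by move=> x y _ _; apply: ext1_inj.
- by move=> x y xtw _; apply: bconvE.
- exact: bcounitE.
- by move=> x y; apply: (twisted_mul (phi := idfun)).
- exact: (twisted1 D idfun).
- by move=> x; apply: (twisted_rinv (phi := idfun)).
Qed.

Lemma bconvVE r : twisted D idfun r -> has_inv r ->
  bconvV (ext1 r) = ext1 (rinv r).
Proof.
apply: (transport_inverse bimod_mapsP).
- by move=> x y _ _; apply: ext1_inj.
- by move=> x y xtw _; apply: bconvE.
- exact: bcounitE.
- by move=> x y; apply: (twisted_mul (phi := idfun)).
- exact: (twisted1 D idfun).
- by move=> x; apply: (twisted_rinv (phi := idfun)).
Qed.

Lemma ext1_mul_src r X b : ext1 r (X ** s b) = ext1 (alpha b * r) X.
Proof. by rewrite /ext1 (ext_mul_src D_bc idfun) push_idfun. Qed.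

Lemma ext1_mul_tgt r X b : twisted D idfun r ->
  ext1 r (X ** t b) = ext1 (r * alpha b) X.
Proof.
by move=> rtw; rewrite /ext1 (ext_mul_tgt D_bc (phi := idfun)) // push_idfun.
Qed.

Lemma BC1P r : BC1 (ext1 r) <-> cochain_C1 D_bc r.
Proof.
have srctgt b X : twisted D idfun r -> ext1 r (X ** s b) = ext1 r (X ** t b) <->
    ext1 (alpha b * r) X = ext1 (r * alpha b) X.
  by move=> rtw; rewrite ext1_mul_src ext1_mul_tgt.
split=> [[/bimod_mapsP[q + /ext1_inj rq]]|[ur r1 rtw vr]].
  rewrite /= -rq => rtw /(invertible_bconv rtw) ur.
  rewrite /ext1 ext1_pure => r1 st.
  split=> // b; apply: ext1_inj; apply: funext => X.
  exact/esym/(srctgt _ _ rtw)/st.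
split.
- by apply/bimod_mapsP; exists r.
- exact/invertible_bconv.
- by rewrite /ext1 ext1_pure.
- by move=> X b; apply/srctgt => //; rewrite vr.
Qed.

Lemma BC1E : @BC1 _ _ LD = ext1 @` cochain_C1 D_bc.
Proof.
apply/seteqP; split=> [U|_ [r /BC1P Cr <-] //].
move=> CU; have [/bimod_mapsP[r _ Ur] _ _ _] := CU.
by rewrite Ur in CU *; exists r => //; apply/BC1P.
Qed.

(** [ext2 c (a # h) (b # g)] is [a (b <| h1) γ(h2, g)], the only [B]-bilinear
    balanced extension of [γ]. *)
Definition ext2 c X Y : B := ext1 (ext alpha c Y) X.

Definition ext2_tensor c : tensorBe LD -> B :=
  fun x => \tsum_(X, Y <- x) ext2 c X Y.

Lemma twisted_ext c Y : bitwisted D_bc c -> twisted D idfun (ext alpha c Y).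
Proof.
move=> [_ c4]; apply: (twisted_sum (phi := idfun)) => b g.
by apply: (twisted_mul (phi := idfun)) => //; apply: twisted_action.
Qed.

(** Balance over the source is built into [ext alpha c]; over the target it
    requires both twisted conditions. *)
Lemma ext2_balanced c : bitwisted D_bc c ->
  balanced (fun (X : LD) (ab : B * B) => X ** s ab.1 ** t ab.2)
    (fun (ab : B * B) (Y : LD) => s ab.1 ** t ab.2 ** Y) (ext2 c).
Proof.
move=> ctw; have Ktw Y := twisted_ext Y ctw; split=> [X X' Y|X Y Y'|X [a b] Y].
- exact: (extD idfun).
- rewrite /ext2 extD /ext1 /ext -tensor_lift_add.
  by apply: eq_tensor_lift => b g; rewrite cochainD mulrDr.
- rewrite /ext2 /= ext1_mul_tgt // ext1_mul_src mulrA.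
  by case: ctw => c3 _; rewrite (ext_bimod D_bc (phi := alpha)).
Qed.

Lemma ext2_tensor_pure c X Y : bitwisted D_bc c ->
  ext2_tensor c (pureBe (L := LD) X Y) = ext2 c X Y.
Proof. by move=> ctw; apply: tensor_lift_pure; apply: ext2_balanced. Qed.

(** [extP] is applied twice: for fixed [Y] it gives a 1-cochain [r Y], and [r]
    itself is a map on the smash product, [alpha]-linear by balance of [G]. *)
Lemma bimod_maps2P (G : tensorBe LD -> B) :
  bimod_maps2 G <-> exists2 c : A2, bitwisted D_bc c & G = ext2_tensor c.
Proof.
split=> [[GD Gbimod]|[c ctw ->]]; last first.
  split; first exact: (tensor_liftD (ext2_balanced ctw)).
  move=> b b' X Y; rewrite !ext2_tensor_pure // /ext2 /ext1.
  by rewrite (ext_bimod D_bc (phi := idfun)) //; apply: twisted_ext.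
have GDl Y : {morph (fun X => G (pureBe (L := LD) X Y)) : X X' / X + X'}.
  by move=> X X'; rewrite -GD /pureBe pureDl.
have GDr X : {morph (fun Y => G (pureBe (L := LD) X Y)) : Y Y' / Y + Y'}.
  by move=> Y Y'; rewrite -GD /pureBe pureDr.
have /choice[r rP] Y : exists r : A1,
    twisted D idfun r /\ forall X, G (pureBe (L := LD) X Y) = ext1 r X.
  have [Ws Wt] := bimod_split D_bc (phi := idfun)
    (fun b b' X => Gbimod b b' X Y).
  have [r rtw rE] := extP D_bc (phi := idfun) (GDl Y) Ws Wt.
  by exists r; split=> // X; rewrite -/(ext1 _) -[LHS]/((fun X => _) X) rE.
have rtw Y : twisted D idfun (r Y) by have [] := rP Y.
have rE X Y : G (pureBe (L := LD) X Y) = ext1 (r Y) X by have [_ ->] := rP Y.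
have r_inj q q' : (forall X, ext1 q X = ext1 q' X) -> q = q'.
  by move=> qq; apply: ext1_inj; apply: funext.
have rD : {morph r : Y Y' / Y + Y'}.
  move=> Y Y'; apply: r_inj => X; rewrite -rE GDr !rE /ext1 /ext.
  by rewrite -tensor_lift_add; apply: eq_tensor_lift => b g;
    rewrite cochainD mulrDr.
have r_bimod b b' Y : r (s b ** t b' ** Y) = alpha b * r Y * alpha b'.
  apply: r_inj => X; rewrite -rE.
  have <- := congr1 G (pure_bal
    (fun (X : LD) (ab : B * B) => X ** s ab.1 ** t ab.2)
    (fun (ab : B * B) (Y : LD) => s ab.1 ** t ab.2 ** Y) X (b, b') Y).
  by rewrite -/(pureBe (L := LD) _ _) rE /= ext1_mul_tgt // ext1_mul_src mulrA.
have [rs rt] := bimod_split D_bc (phi := alpha) r_bimod.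
have [c c3 rc] := extP D_bc (phi := alpha) rD rs rt.
exists c.
  split=> // g; have := rtw (1 \ox g); rewrite rc ext_pure rmorph1 mul1r.
  exact.
apply: funext => x; rewrite (tensor_additiveE _ GD).
apply: eq_tensor_lift => X Y.
by rewrite -/(pureBe (L := LD) _ _) rE rc.
Qed.

Lemma ext2_tensor_inj c d : bitwisted D_bc c -> bitwisted D_bc d ->
  ext2_tensor c = ext2_tensor d -> c = d.
Proof.
move=> ctw dtw cd; apply: (ext_inj (phi := alpha)); first exact: rmorph1.
move=> Y; apply: ext1_inj; apply: funext => X.
by rewrite -!/(ext2 _ X Y) -!ext2_tensor_pure // cd.
Qed.

(** The sum over the coproduct of [X] is computed first: for fixed [X1], [X2]
    the summand is not balanced in [Y]. *)
Lemma bconv2E c d : bitwisted D_bc c -> bitwisted D_bc d ->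
  bconv2 (ext2_tensor c) (ext2_tensor d) = ext2_tensor (c * d).
Proof.
move=> ctw dtw; apply: funext => x; apply: eq_tensor_lift => X Y /=.
rewrite tsum_exchange; have [c3 _] := ctw.
transitivity (\tsum_(Y1, Y2 <- smash_comul D Y)
    ext1 (ext alpha c Y1 * ext alpha d Y2) X).
  apply: eq_tensor_lift => Y1 Y2.
  rewrite -ext1_comul; last exact: twisted_ext.
  by apply: eq_tensor_lift => X1 X2; rewrite !ext2_tensor_pure.
by rewrite -(ext_tsuml idfun) (ext_comul D_bc (phi := alpha)).
Qed.

Lemma bconv2_1E : @bconv2_1 _ _ LD = ext2_tensor 1.
Proof.
apply: funext => x; apply: eq_tensor_lift => X Y /=.
by rewrite -ext_counit (ext_mul_id D_bc) rmorph1.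
Qed.

Lemma invertible_bconv2 c : bitwisted D_bc c ->
  invertible (@bimod_maps2 _ _ LD) (@bconv2 _ _ LD) (@bconv2_1 _ _ LD)
    (ext2_tensor c) <-> has_inv c.
Proof.
apply: (transport_invertible bimod_maps2P).
- exact: ext2_tensor_inj.
- exact: bconv2E.
- exact: bconv2_1E.
- exact: bitwisted_mul.
- exact: bitwisted1.
- by move=> d ud; apply: bitwisted_inv.
Qed.

(** The two sides of the cocycle identity are threefold extensions of the two
    words of [cocycle]; as extensions determine their cochain, the identities
    are equivalent. *)
Lemma cocycle_left c X Y Z : bitwisted D_bc c ->
  \tsum_(Y1, Y2 <- smash_comul D Y) \tsum_(Z1, Z2 <- smash_comul D Z)
    ext2_tensor c (pureBe (L := LD) X
      (s (ext2_tensor c (pureBe (L := LD) Y1 Z1)) ** Y2 ** Z2)) =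
  ext1 (ext alpha (ext psi (push (push alpha) c * opmul c) Z) Y) X.
Proof.
move=> ctw; have [c3 _] := ctw; rewrite tsum_exchange.
transitivity (\tsum_(Z1, Z2 <- smash_comul D Z)
    ext1 (ext alpha (ext psi (push (push alpha) c) Z1 *
                     ext psi (opmul c) Z2) Y) X).
  apply: eq_tensor_lift => Z1 Z2.
  rewrite -(push_ext alpha (push alpha)) -(ext_comul D_bc (phi := alpha)).
    rewrite /ext1 ext_tsuml; apply: eq_tensor_lift => Y1 Y2.
    rewrite !ext2_tensor_pure // /ext2 /ext1 (ext_mul D_bc alpha).
    rewrite (ext_src D_bc alpha).
    by rewrite (push_ext idfun alpha).
  exact: (twisted_push (phi := idfun) alpha (twisted_ext _ ctw)).
rewrite -(ext_tsuml idfun) -(ext_tsuml alpha) (ext_comul D_bc (phi := psi)) //.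
exact: (twisted_push (phi := alpha) (push alpha) c3).
Qed.

Lemma cocycle_right c X Y Z : bitwisted D_bc c ->
  (forall b, c * opmul (alpha b) = opmul (alpha b) * c) ->
  \tsum_(X1, X2 <- smash_comul D X) \tsum_(Y1, Y2 <- smash_comul D Y)
    ext2_tensor c (pureBe (L := LD)
      (s (ext2_tensor c (pureBe (L := LD) X1 Y1)) ** X2 ** Y2) Z) =
  ext1 (ext alpha (ext psi (const S c * push opmul c) Z) Y) X.
Proof.
move=> ctw cC; have [c3 _] := ctw; rewrite tsum_exchange.
have psiE : psi = opmul \o alpha.
  by apply: funext => b; rewrite /= push_action.
transitivity (\tsum_(Y1, Y2 <- smash_comul D Y)
    ext1 (ext alpha c Y1 * ext alpha (opmul (ext alpha c Z)) Y2) X).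
  apply: eq_tensor_lift => Y1 Y2.
  rewrite -ext1_comul; last exact: twisted_ext.
  apply: eq_tensor_lift => X1 X2.
  rewrite !ext2_tensor_pure // /ext2 {1}/ext1 (ext_mul_id D_bc).
  by rewrite (ext_src D_bc idfun).
rewrite -(ext_tsuml idfun) (ext_comul D_bc (phi := alpha)) //.
rewrite (push_ext alpha opmul) psiE.
by rewrite (mul_ext (phi := opmul \o alpha)).
Qed.

Lemma ext2_tensor_unit c X : bitwisted D_bc c ->
  ext2_tensor c (pureBe (L := LD) (smash_one H B) X) = ext1 (push at1 c) X /\
  ext2_tensor c (pureBe (L := LD) X (smash_one H B)) = ext1 (at1 c) X.
Proof.
move=> ctw; rewrite !ext2_tensor_pure // /ext2 /smash_one; split.
  rewrite {1}/ext1 ext1_pure -/(at1 _) (push_ext alpha at1).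
  by apply: eq_tensor_lift => b g; rewrite /= /at1 /= act1.
by rewrite ext_pure rmorph1 mul1r.
Qed.

Lemma ext2_tensor_srctgt c X Y b : bitwisted D_bc c ->
  ext2_tensor c (pureBe (L := LD) X (Y ** s b)) =
    ext1 (ext alpha (opmul (alpha b) * c) Y) X /\
  ext2_tensor c (pureBe (L := LD) X (Y ** t b)) =
    ext1 (ext alpha (c * opmul (alpha b)) Y) X.
Proof.
move=> ctw; have [c3 _] := ctw; rewrite !ext2_tensor_pure // /ext2.
rewrite (ext_mul_src D_bc alpha) (ext_mul_tgt D_bc (phi := alpha)) //.
by rewrite push_action.
Qed.

Lemma ext_alpha_inj c d :
  (forall X Y, ext1 (ext alpha c Y) X = ext1 (ext alpha d Y) X) -> c = d.
Proof.
move=> cd; apply: (ext_inj (phi := alpha)); first exact: rmorph1.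
by move=> Y; apply: ext1_inj; apply: funext => X.
Qed.

Lemma BZ2P c : bitwisted D_bc c ->
  BZ2 (L := LD) (ext2_tensor c) <-> cochain_Z2 D_bc c.
Proof.
move=> ctw; split=> [[_ + cc c1 cst]|[uc [c1 c1'] cc cC _]].
  move=> /(invertible_bconv2 ctw) uc.
  have cC b : c * opmul (alpha b) = opmul (alpha b) * c.
    apply: ext_alpha_inj => X Y; have [sE tE] := ext2_tensor_srctgt X Y b ctw.
    by rewrite -sE -tE; apply/esym/cst.
  split=> //.
    split; apply: ext1_inj; apply: funext => X; have [l r] := c1 X.
      by have [_ <-] := ext2_tensor_unit X ctw; rewrite -bcounitE.
    by have [<- _] := ext2_tensor_unit X ctw; rewrite -bcounitE.
  rewrite /cocycle; apply: (ext_inj (phi := psi)); first by rewrite rmorph1.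
  move=> Z; apply: ext_alpha_inj => X Y.
  rewrite -(cocycle_left _ _ _ ctw) -(cocycle_right _ _ _ ctw cC).
  exact: cc.
split.
- by apply/bimod_maps2P; exists c.
- exact/invertible_bconv2.
- move=> X Y Z; rewrite (cocycle_left _ _ _ ctw) (cocycle_right _ _ _ ctw cC).
  by rewrite cc.
- move=> X; have [-> ->] := ext2_tensor_unit X ctw.
  by rewrite c1 c1' -bcounitE.
- move=> X Y b; have [-> ->] := ext2_tensor_srctgt X Y b ctw.
  by rewrite cC.
Qed.

Lemma BZ2E : @BZ2 _ _ LD = ext2_tensor @` cochain_Z2 D_bc.
Proof.
apply/seteqP; split=> [G|_ [c Zc <-]]; last first.
  by apply/BZ2P => //; have [] := Zc.
move=> ZG; have [/bimod_maps2P[c ctw Gc] _ _ _ _] := ZG.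
by rewrite Gc in ZG *; exists c => //; apply/(BZ2P ctw).
Qed.

(** As for [bconv2E], the sums over the coproducts of [X] are moved inside. *)
Lemma bgaugeE c r : bitwisted D_bc c -> cochain_C1 D_bc r ->
  bgauge (L := LD) (ext2_tensor c) (ext1 r) =
  ext2_tensor (cochain_gauge D_bc c r).
Proof.
move=> ctw Cr; have [ur _ rtw vr] := Cr; have [_ _ Vtw vV] := cochain_C1_inv Cr.
have [c3 _] := ctw.
apply: funext => x; apply: eq_tensor_lift => X Y; rewrite (bconvVE rtw ur) /=.
set V := rinv r in Vtw vV *.
pose F X1 X2 X3 Y1 Y2 Y3 : B := ext1 V (X1 ** t (ext1 V Y1)) *
  ext2_tensor c (pureBe (L := LD) X2 Y2) * ext1 r (X3 ** Y3).
transitivity (\tsum_(Y1, Y' <- smash_comul D Y)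
  \tsum_(Y2, Y3 <- smash_comul D Y') \tsum_(X1, X' <- smash_comul D X)
  \tsum_(X2, X3 <- smash_comul D X') F X1 X2 X3 Y1 Y2 Y3).
  transitivity (\tsum_(X1, X' <- smash_comul D X)
    \tsum_(Y1, Y' <- smash_comul D Y) \tsum_(Y2, Y3 <- smash_comul D Y')
    \tsum_(X2, X3 <- smash_comul D X') F X1 X2 X3 Y1 Y2 Y3).
    apply: eq_tensor_lift => X1 X'; rewrite tsum_exchange.
    by apply: eq_tensor_lift => Y1 Y'; apply: tsum_exchange.
  rewrite tsum_exchange; apply: eq_tensor_lift => Y1 Y'.
  exact: tsum_exchange.
transitivity (\tsum_(Y1, Y' <- smash_comul D Y)
  \tsum_(Y2, Y3 <- smash_comul D Y')
  ext1 (V * (ext alpha (push alpha V) Y1 *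
             (ext alpha c Y2 * ext alpha (opmul r) Y3))) X).
  apply: eq_tensor_lift => Y1 Y'; apply: eq_tensor_lift => Y2 Y3.
  have aE : alpha (ext1 V Y1) = ext alpha (push alpha V) Y1.
    exact: (push_ext idfun alpha).
  rewrite [V * _]mulrA -aE -ext1_comul; last first.
    by apply: (twisted_mul (phi := idfun)) => //; apply: twisted_action.
  apply: eq_tensor_lift => X1 X'.
  rewrite -[ext1 (ext _ _ _ * _) _]ext1_comul; last exact: twisted_ext.
  rewrite mulr_tsumr.
  apply: eq_tensor_lift => X2 X3.
  rewrite /F ext1_mul_tgt // ext2_tensor_pure // mulrA; congr (_ * _).
  exact: (ext_mul_id D_bc).
transitivity (\tsum_(Y1, Y' <- smash_comul D Y)
  ext1 (V * (ext alpha (push alpha V) Y1 * ext alpha (c * opmul r) Y')) X).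
  apply: eq_tensor_lift => Y1 Y'; rewrite -(ext_tsuml idfun) -mulr_tsumr.
  rewrite -mulr_tsumr; congr (ext1 (_ * (_ * _)) X).
  exact: (ext_comul D_bc (phi := alpha)).
rewrite -(ext_tsuml idfun) -mulr_tsumr (ext_comul D_bc (phi := alpha)).
  rewrite (mul_ext (phi := alpha)); last exact: vV.
  by rewrite /ext2 /cochain_gauge !mulrA.
exact: (twisted_push (phi := idfun) alpha Vtw).
Qed.

(** The factors are reversed, which is why the opposite group appears. *)
Lemma bis_mulE r q : twisted D idfun q ->
  bis_mul (L := LD) (ext1 r) (ext1 q) = ext1 (q * r).
Proof.
move=> qtw; apply: funext => X; rewrite -ext1_comul //.
by apply: eq_tensor_lift => X1 X2; rewrite {1}/ext1 (ext_src D_bc idfun).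
Qed.

(** [r (S h1) <| h2] is a left and [r (S^-1 h2) <| h1] a right convolution
    inverse of [r], each by one of the two forms of multiplicativity. *)
Lemma has_inv_opmul r : bijective (antipode S) -> r 1 = 1 ->
  (forall g, opmul r g = alpha (r g) * r) ->
  (forall g, opmul r g = r * alpha (r g)) -> has_inv r.
Proof.
move=> /antipode_inverse[T Tlin TE] r1 rl rr.
have l_lin : linear (fun h => sw2 S h (fun h1 h2 =>
    act D (r (antipode S h1)) h2)).
  apply: sw2_linear => [y|x] c u v; last exact: act_linearr.
  by rewrite !linearP; apply: act_linearl.
have q_lin : linear (fun h => sw2 S h (fun h1 h2 => act D (r (T h2)) h1)).
  apply: sw2_linear => [y|x] c u v; first exact: act_linearr.
  by rewrite Tlin !linearP; apply: act_linearl.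
pose l := Cochain S l_lin; pose q := Cochain S q_lin.
have lr : l * r = 1.
  apply: cochainP => h; rewrite cochainM.
  under eq_sw2 => x h3 do rewrite mulr_sw2l.
  rewrite (sw2A S h (F := fun x y z => act D (r (antipode S x)) y * r z)).
  - transitivity (sw2 S h (fun h1 h2 => r (antipode S h1 * h2))).
      by apply: eq_sw2 => h1 x; rewrite -opmulE rl.
    by rewrite -linear_sw2 [sw2 _ _ _](antipodel S) linearZ /= r1.
  - move=> z; apply: bilinear_kbalanced => [y|x] c u v /=.
      by rewrite !linearP -[act D _ _]/(alpha _ y) linearP mulrDl scalerAl.
    by rewrite act_linearr mulrDl scalerAl.
  - move=> x; apply: bilinear_kbalanced => [z|y] c u v /=.
      by rewrite act_linearr mulrDl scalerAl.
    by rewrite linearP mulrDr scalerAr.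
have rq : r * q = 1.
  apply: cochainP => h; rewrite cochainM.
  under eq_sw2 => x h3 do rewrite mulr_sw2r.
  rewrite -(sw2A S h (F := fun x y z => r x * act D (r (T z)) y)).
  - transitivity (sw2 S h (fun h1 h2 => r (T h2 * h1))).
      by apply: eq_sw2 => x h3; rewrite -opmulE rr.
    by rewrite -linear_sw2 TE linearZ /= r1.
  - move=> z; apply: bilinear_kbalanced => [y|x] c u v /=.
      by rewrite linearP mulrDl scalerAl.
    by rewrite act_linearr mulrDr scalerAr.
  - move=> x; apply: bilinear_kbalanced => [z|y] c u v /=.
      by rewrite act_linearr mulrDr scalerAr.
    by rewrite Tlin !linearP -[act D _ _]/(alpha _ y) linearP mulrDr scalerAr.
by apply: (has_invP rq); rewrite (rinv_unique rq lr).
Qed.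

(** A bisection is linear over the source because
    [s b ** s (sg X) = s (b * sg X)]. Its two product formulas, evaluated at
    [Y = s b], give verticality of the 1-cochain and, at [Y = 1 # g], its
    multiplicativity. *)
Lemma BverE : bijective (antipode S) -> @Bver _ _ LD = ext1 @` cochain_Z1 D_bc.
Proof.
move=> S_bij; apply/seteqP; split=> [sg|_ [r [Cr /(cochain_Z1P Cr) r1] <-]].
  move=> [sl s1 st ss sM].
  have sgs b X : sg (s b ** X) = b * sg X.
    have [_ ->] := sM (s b) X.
    by rewrite /= [_ ** s _](src_pure D) -[_ \ox 1]/(s _) ss.
  have [r rtw sgE] := extP D_bc (phi := idfun) (linear_morphD sl) sgs st.
  rewrite -/(ext1 r) in sgE; rewrite sgE in sM s1 ss *.
  have rE Y : ext alpha (opmul r) Y = r * alpha (ext1 r Y) /\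
      ext alpha (opmul r) Y = alpha (ext1 r Y) * r.
    split; apply: ext1_inj; apply: funext => X; rewrite -[LHS](ext_mul_id D_bc).
      by rewrite -ext1_mul_tgt //; apply: (sM X Y).1.
    by rewrite -ext1_mul_src; apply: (sM X Y).2.
  have vr : vertical D_bc r.
    by move=> b; have [rl rr] := rE (s b); move: rl; rewrite rr ss.
  have r1 : r 1 = 1 by rewrite -s1 /ext1 ext1_pure.
  have rl g : opmul r g = alpha (r g) * r.
    have [_] := rE (1 \ox g).
    by rewrite ext_pure rmorph1 mul1r /ext1 ext1_pure.
  have ur : has_inv r.
    by apply: has_inv_opmul => // g; rewrite rl vr.
  have Cr : cochain_C1 D_bc r by split.
  exists r => //; split=> //; apply/(cochain_Z1P Cr).
  by apply: cochainP => g; rewrite constMr rl.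
have [ur ur1 rtw vr] := Cr.
have rE Y : ext alpha (opmul r) Y = alpha (ext1 r Y) * r.
  rewrite (push_ext idfun alpha) /ext mulr_tsuml r1.
  by apply: eq_tensor_lift => b g; rewrite constMr mulrA.
split.
- exact: (ext_linear idfun).
- by rewrite /ext1 ext1_pure.
- by move=> b X; apply: (ext_tgt D_bc (phi := idfun)).
- by move=> b; rewrite /ext1 ext_pure [r 1]ur1 mulr1.
- move=> X Y; rewrite /= ext1_mul_tgt // ext1_mul_src vr -rE.
  by split; apply: (ext_mul_id D_bc).
Qed.

End Algebroid.

(** * Comparison of the two cohomologies *)

Theorem theorem5p7 (k : fieldType) (H : algType k) (S : hopf_algebra H)
    (S_bij : bijective (antipode S))
    (B : algType k) (D : dy_module S B) (D_bc : braided_commutative D) :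
  [/\ is_group (C1_ver D) (conv S) (conv1 S B),
      forall rho, C1_ver D rho ->
        Z2 D (coboundary D rho) /\
        forall h g, coboundary D rho (h \ox g) =
          sw3 S h (fun h1 h2 h3 => sw2 S g (fun g1 g2 =>
            convV S rho h1 * act D (convV S rho g1) h2 * rho (g2 * h3))),
      is_subgroup (Z1_ver D) (C1_ver D) (conv S) (conv1 S B)
    & is_group (@Bver _ _ (smash D)) (@bis_mul _ _ (smash D))
        (@bcounit _ _ (smash D)) /\
      group_isomorphic (Z1_ver D) (conv S)
        (@Bver _ _ (smash D)) (opposite (@bis_mul _ _ (smash D)))] /\
  [/\ is_right_action (C1_ver D) (conv S) (conv1 S B) (Z2 D) (gauge D),
      forall gamma rho, Z2 D gamma -> C1_ver D rho ->
        forall h g, gauge D gamma rho (h \ox g) =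
          sw4 S h (fun h1 h2 h3 h4 => sw3 S g (fun g1 g2 g3 =>
            convV S rho h1 * act D (convV S rho g1) h2 *
            gamma (h3 \ox g2) * rho (g3 * h4)))
    & exists f, set_bij (H2_act D) (@BH2 _ _ (smash D)) f].
Proof.
have gC := cochain_C1_group D_bc; have gZ := cochain_Z1_group D_bc.
have gA := cochain_gauge_action D_bc.
have Z1C r : cochain_Z1 D_bc r -> cochain_C1 D_bc r by case.
have Ctw r : cochain_C1 D_bc r -> twisted D idfun r by case.
have Ztw c : cochain_Z2 D_bc c -> bitwisted D_bc c by case.
have isZ1 : is_group (Z1_ver D) (conv S) (conv1 S B).
  by rewrite (Z1_verE D_bc); apply: (transport_group _ gZ).
have BisE r q : cochain_Z1 D_bc r -> cochain_Z1 D_bc q ->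
    bis_mul (L := smash D) (ext1 r) (ext1 q) = ext1 (q * r).
  by move=> _ Zq; apply/(bis_mulE D_bc)/Ctw/Z1C.
split; split.
- by rewrite (C1_verE D_bc); apply: (transport_group _ gC).
- move=> rho; rewrite (C1_verE D_bc) => -[r Cr <-].
  have [ur _ _ _] := Cr; rewrite (coboundaryE Cr).
  split; first exact/Z2P/(gauge_in (cochain_Z2_1 D_bc) Cr).
  by move=> h g; rewrite uncurry_pure cochain_gauge1E (convVE ur).
- by split=> // rho [].
- split.
    rewrite (BverE D_bc S_bij) (bcounitE D).
    by apply: transport_group (opposite_group gZ) => r q; apply: BisE.
  exists (fun rho X => \tsum_(a, h <- X) (a * rho h)); split.
    rewrite (Z1_verE D_bc) (BverE D_bc S_bij); split.
    + by move=> _ [r Zr <-]; exists r.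
    + move=> x y; rewrite !inE => -[r _ <-] [q _ <-] rq.
      by congr cfun; apply: (@ext1_inj _ _ S _ D).
    + by move=> _ [r Zr <-]; exists (r : H -> B) => //; exists r.
  move=> x y; rewrite (Z1_verE D_bc) => -[r Zr <-] [q Zq <-].
  exact/esym/(BisE q r Zq Zr).
- rewrite (C1_verE D_bc) (Z2E D_bc).
  by apply: (transport_action _ _ gC gA) => // c r _ Cr; apply: gaugeE.
- move=> gamma rho; rewrite (C1_verE D_bc) (Z2E D_bc).
  move=> [c Zc <-] [r Cr <-] h g.
  have [ur _ _ _] := Cr; rewrite (gaugeE _ Cr) uncurry_pure.
  rewrite cochain_gaugeE (convVE ur).
  apply: eq_sw2 => h1 t; apply: eq_sw2 => h2 u; apply: eq_sw2 => h3 h4.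
  by apply: eq_sw2 => g1 v; apply: eq_sw2 => g2 g3; rewrite uncurry_pure.
- apply: (@set_bij_common_source _ _ _
    (orbits (cochain_C1 D_bc) (cochain_Z2 D_bc) (cochain_gauge D_bc)) _ _
    (image^~ (@uncurry _ _ S B)) (image^~ (@ext2_tensor _ _ _ _ _ D_bc))).
    rewrite /H2_act (C1_verE D_bc) (Z2E D_bc); apply: transport_orbits.
    + by move=> c r _ Cr; apply: gaugeE.
    + by move=> c d _ _; apply: uncurry_inj.
    + exact: gauge_in.
  rewrite /BH2 (BC1E D_bc) (BZ2E D_bc); apply: transport_orbits.
  + by move=> c r /Ztw ctw Cr; apply: bgaugeE.
  + by move=> c d /Ztw ctw /Ztw dtw; apply: ext2_tensor_inj.
  + exact: gauge_in.
Qed.
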